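(* Let $X$ be a sequentially complete Fréchet space and $1\le p<+\infty$. Then the space $L^p([a,b];X)$ is a closed subspace of $\mathcal{U}^p([a,b];X)$. Furthermore, $L^p([a,b];X)$ is a sequentially complete Fréchet space.
   Context: $[a,b]$ is a compact interval. A locally convex space is a vector space with a topology generated by semi-norms for which there is a separating family of continuous semi-norms. A Fréchet space, here and for every space in the claim, is a locally convex space whose topology can be generated by a countable collection of continuous semi-norms. Completeness is not part of this definition. A locally convex space is sequentially complete if every sequence that is Cauchy with respect to each continuous semi-norm converges to some element of the space. Let $\mathcal{P}=\{\rho_i:i\in\mathbb{N}\}$ be a countable separating family of continuous semi-norms generating the topology of $X$. A gauge on $[a,b]$ is a function $\delta:[a,b]\to(0,\infty)$. A tagged partition of $[a,b]$ is a finite collection $D=\{([u_i,v_i],t_i):1\le i\le n\}$ of non-overlapping non-degenerate closed intervals with union $[a,b]$ and tags $t_i\in[u_i,v_i]$. It is $\delta$-fine if $[u_i,v_i]\subseteq(t_i-\delta(t_i),t_i+\delta(t_i))$ for every $i$. For such $D$, $(D)\sum$ denotes summation over the members $([u,v],t)$ of $D$. For a semi-norm $\rho$ on $X$, a function $f:[a,b]\to X$ and $1\le p<\infty$, put $$\mu^p_\rho(f,[a,b])=\inf_{\text{gauge }\delta}\ \sup\Big\{(D)\sum \rho(f(t))^p\,(v-u): D\text{ is a }\delta\text{-fine tagged partition of }[a,b]\Big\}\in[0,\infty],$$ and $\|f\|_{\mathcal{U}^p_\rho}=\mu^p_\rho(f,[a,b])^{1/p}$. $\mathcal{U}^p([a,b];X)$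 is the space of all functions $f:[a,b]\to X$ with $\mu^p_\rho(f,[a,b])<\infty$ for every continuous semi-norm $\rho$ on $X$, with the topology given by the countable collection of semi-norms $\{\|\cdot\|_{\mathcal{U}^p_{\rho_i}}:i\in\mathbb{N}\}$. For a semi-norm $\rho$ on $X$, a function $f:[a,b]\to X$ is $\rho$-SKH integrable if there is a function $F:[a,b]\to X$ such that for every $\varepsilon>0$ there is a gauge $\delta$ on $[a,b]$ with $(D)\sum\rho\big(F(v)-F(u)-f(t)(v-u)\big)<\varepsilon$ for every $\delta$-fine tagged partition $D$ of $[a,b]$. A function $g:[a,b]\to\mathbb{R}$ is Kurzweil--Henstock integrable if there is $z\in\mathbb{R}$ such that for every $\varepsilon>0$ there is a gauge $\delta$ on $[a,b]$ with $|(D)\sum g(t)(v-u)-z|<\varepsilon$ for every $\delta$-fine tagged partition $D$ of $[a,b]$. The function $f$ is $L^p_\rho$-integrable if $f$ is $\rho$-SKH integrable and $t\mapsto\rho(f(t))^p$ is Kurzweil--Henstock integrable on $[a,b]$. $L^p([a,b];X)$ is the space of all functions $f:[a,b]\to X$ that are $L^p_\rho$-integrable for every continuous semi-norm $\rho$ on $X$, with the topology inherited from $\mathcal{U}^p([a,b];X)$.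
   Formalization: That L^p([a,b];X) is a Fréchet space is proved after identifying functions that no continuous semi-norm distinguishes, since a function supported at one point has all semi-norms 0; the other claims hold for the function space itself. *)

(* Defs.v *)
From HB Require Import structures.
From mathcomp Require Import all_boot all_order all_algebra.
From mathcomp Require Import all_classical all_reals all_analysis.

Set Implicit Arguments.
Unset Strict Implicit.
Unset Printing Implicit Defensive.

Import Order.TTheory GRing.Theory Num.Theory.
Import numFieldNormedType.Exports.

Local Open Scope classical_set_scope.
Local Open Scope ring_scope.

Section seminorms.
Context {R : realType}.

Definition seminorm (V : lmodType R) (q : V -> R) : Prop :=
  [/\ forall x, 0 <= q x,
      forall x y, q (x + y) <= q x + q y
    & forall (c : R) x, q (c *: x) = `|c| * q x].

Definition continuous_seminorm (V : preTopologicalLmodType R) (q : V -> R)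
  : Prop := seminorm q /\ continuous q.

Definition separating (V : lmodType R) (I : Type) (Q : I -> V -> R) : Prop :=
  forall x, x != 0 -> exists i, Q i x != 0.

Definition seminorm_ball (V : lmodType R) (I : Type) (Q : I -> V -> R)
    (F : set I) (x : V) (e : R) : set V :=
  [set y | forall i, F i -> Q i (y - x) < e].

Definition seminorm_open (V : lmodType R) (I : Type) (Q : I -> V -> R)
    (A : set V) : Prop :=
  forall x, A x -> exists F : set I, exists e : R,
    [/\ finite_set F, 0 < e & seminorm_ball Q F x e `<=` A].

Definition generates_topology (V : preTopologicalLmodType R) (I : Type)
    (Q : I -> V -> R) : Prop :=
  forall A : set V, open A <-> seminorm_open Q A.

Definition locally_convex_space (V : preTopologicalLmodType R) : Prop :=
  (exists (I : Type) (Q : I -> V -> R),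
     (forall i, seminorm (Q i)) /\ generates_topology Q) /\
  (exists (I : Type) (Q : I -> V -> R),
     (forall i, continuous_seminorm (Q i)) /\ separating Q).

Definition countably_generated (V : preTopologicalLmodType R) : Prop :=
  exists Q : nat -> V -> R,
    (forall i, continuous_seminorm (Q i)) /\ generates_topology Q.

(* Completeness is not part of this notion. *)
Definition frechet (V : preTopologicalLmodType R) : Prop :=
  locally_convex_space V /\ countably_generated V.

Definition seminorm_cauchy (V : lmodType R) (q : V -> R) (u : nat -> V)
  : Prop :=
  forall e : R, 0 < e -> exists N : nat, forall m n : nat,
    (N <= m)%N -> (N <= n)%N -> q (u m - u n) < e.

Definition sequentially_complete (V : preTopologicalLmodType R) : Prop :=
  forall u : nat -> V,
    (forall q : V -> R, continuous_seminorm q -> seminorm_cauchy q u) ->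
    exists l : V, u n @[n --> \oo] --> l.

End seminorms.

Definition seminormed (R : realType) (V : lmodType R) (I : Type)
  (Q : I -> V -> R) : Type := V.

Section seminormed_topology.
Context {R : realType} {V : lmodType R} {I : Type} (Q : I -> V -> R).

Lemma seminorm_openT : seminorm_open Q setT.
Proof.
by move=> x _; exists set0; exists 1; split => //; exact: finite_set0.
Qed.

Lemma seminorm_openI : setI_closed (seminorm_open Q).
Proof.
move=> A B oA oB x [Ax Bx].
have [F [e [finF e0 FA]]] := oA _ Ax; have [G [d [finG d0 GB]]] := oB _ Bx.
exists (F `|` G), (Num.min e d); split.
- by rewrite finite_setU.
- by rewrite lt_min e0 d0.
- move=> y FGy; split.
  + by apply: FA => i Fi; have := FGy i (or_introl Fi);
    rewrite lt_min => /andP[].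
  + by apply: GB => i Gi; have := FGy i (or_intror Gi);
    rewrite lt_min => /andP[].
Qed.

Lemma seminorm_open_bigU (J : Type) (f : J -> set V) :
  (forall j, seminorm_open Q (f j)) -> seminorm_open Q (\bigcup_j f j).
Proof.
move=> of_ x [j _ fjx]; have [F [e [finF e0 Ff]]] := of_ j x fjx.
by exists F, e; split => // y /Ff fy; exists j.
Qed.

HB.instance Definition _ := GRing.Lmodule.copy (seminormed Q) V.
HB.instance Definition _ := isOpenTopological.Build (seminormed Q)
  seminorm_openT seminorm_openI seminorm_open_bigU.

End seminormed_topology.

(* The closure proof is a parameter so that the canonical vector space
   structure of the subtype can be keyed on it. *)
Definition subspace_pred (R : realType) (V : lmodType R) (S : set V)
  (hS : submod_closed [in S]) : {pred V} := [in S].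

Definition linear_subspace (R : realType) (V : lmodType R) (S : set V)
  (hS : submod_closed [in S]) : Type := {x : V | subspace_pred hS x}.

Section linear_subspace_lmod.
Context {R : realType} {V : lmodType R} {S : set V}.
Context (hS : submod_closed [in S]).

HB.instance Definition _ := GRing.isSubmodClosed.Build R V (subspace_pred hS)
  (GRing.submod_closed_semi hS).

HB.instance Definition _ := [isSub of linear_subspace hS for @sval _ _].
HB.instance Definition _ := [Choice of linear_subspace hS by <:].
HB.instance Definition _ :=
  [SubChoice_isSubLmodule of linear_subspace hS by <:].

End linear_subspace_lmod.

(* The topology inherited from the ambient space, on an alias because the
   ambient space of [linear_subspace] need not carry a topology. *)
Definition topological_subspace (R : realType) (V : preTopologicalLmodType R)
  (S : set V) (hS : submod_closed [in S]) : Type := linear_subspace hS.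

Section topological_subspace.
Context {R : realType} {V : preTopologicalLmodType R} {S : set V}.
Context (hS : submod_closed [in S]).

HB.instance Definition _ :=
  GRing.Lmodule.copy (topological_subspace hS) (linear_subspace hS).
HB.instance Definition _ := Topological.copy (topological_subspace hS)
  (initial_topology (\val : linear_subspace hS -> V)).

End topological_subspace.

Definition null_pred (R : realType) (V : preTopologicalLmodType R) : {pred V} :=
  fun x => `[< forall q : V -> R, continuous_seminorm q -> q x = 0 >].

Section null_pred_closed.
Context {R : realType} {V : preTopologicalLmodType R}.

Lemma null_predZ (c : R) (x : V) : null_pred x -> null_pred (c *: x).
Proof.
move=> /asboolP x0; apply/asboolP => q qc; have [[_ _ ->] _] := qc.
by rewrite (x0 q qc) mulr0.
Qed.

Lemma null_pred_zmod_closed : zmod_closed (@null_pred R V).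
Proof.
split.
  apply/asboolP => q [[_ _ qZ] _].
  by rewrite -(scale0r (0 : V)) qZ normr0 mul0r.
move=> x y x0 y0; have /asboolP xP := x0.
have /asboolP yP := null_predZ (-1) y0.
apply/asboolP => q qc; have [[q0 qD _] _] := qc.
apply/eqP; rewrite eq_le q0 andbT; apply: le_trans (qD x (- y)) _.
by rewrite xP// -scaleN1r yP// addr0.
Qed.

HB.instance Definition _ :=
  GRing.isZmodClosed.Build V (@null_pred R V) null_pred_zmod_closed.

End null_pred_closed.

(* The quotient of V by [null_pred], with the quotient topology. Spaces of
   functions on [a, b] need it: a function that is nonzero at a single point is
   annihilated by every continuous semi-norm, so before this identification
   their continuous semi-norms are not separating. *)
Definition separated_space (R : realType) (V : preTopologicalLmodType R)
  : Type :=
  quotient_topology (ring_quotient.Quotient.quot (@null_pred R V)).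

Section separated_space.
Local Open Scope quotient_scope.
Context {R : realType} {V : preTopologicalLmodType R}.
Local Notation Q := (ring_quotient.Quotient.quot (@null_pred R V)).

Definition separated_scale (c : R) (x : Q) : Q := \pi_Q (c *: repr x).

Lemma pi_separated_scale (c : R) (x : V) :
  separated_scale c (\pi_Q x) = \pi_Q (c *: x).
Proof.
apply/eqP; rewrite -ring_quotient.Quotient.idealrBE -scalerBr.
apply: null_predZ; rewrite -[null_pred _]/(_ \in @null_pred R V).
by rewrite ring_quotient.Quotient.idealrBE reprK.
Qed.

Lemma separated_scaleA (a b : R) (x : Q) :
  separated_scale a (separated_scale b x) = separated_scale (a * b) x.
Proof.
elim/quotW: x => x; rewrite (pi_separated_scale b x).
by rewrite !pi_separated_scale scalerA.
Qed.

Lemma separated_scale1 : left_id 1 separated_scale.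
Proof. by elim/quotW=> x; rewrite pi_separated_scale scale1r. Qed.

Lemma separated_scaleDr : right_distributive separated_scale +%R.
Proof.
move=> c; elim/quotW=> x; elim/quotW=> y.
by rewrite -raddfD !pi_separated_scale scalerDr raddfD.
Qed.

Lemma separated_scaleDl (x : Q) : {morph separated_scale^~ x : a b / a + b}.
Proof.
by move=> a b; elim/quotW: x => x; rewrite !pi_separated_scale scalerDl raddfD.
Qed.

HB.instance Definition _ :=
  Topological.copy (separated_space V) (quotient_topology Q).
HB.instance Definition _ := GRing.isZmodule.Build (separated_space V)
  (@ring_quotient.Quotient.addqA _ _) (@ring_quotient.Quotient.addqC _ _)
  (@ring_quotient.Quotient.add0q _ _) (@ring_quotient.Quotient.addNq _ _).
HB.instance Definition _ := GRing.Zmodule_isLmodule.Build R (separated_space V)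
  separated_scaleA separated_scale1 separated_scaleDr separated_scaleDl.

End separated_space.

Definition interval_type (R : realType) (a b : R) : Type :=
  {x : R | x \in `[a, b]}.

Section partitions.
Context {R : realType} {a b : R}.
Local Notation I := (interval_type a b).

Record tagged_interval :=
  TaggedInterval { left_end : I ; right_end : I ; tag_point : I }.

Definition tagged_width (c : tagged_interval) : R :=
  sval (right_end c) - sval (left_end c).

Definition is_gauge (delta : I -> R) : Prop := forall t, 0 < delta t.

(* The finite collection is enumerated by a sequence; the first two conditions
   exclude repetitions. For non-degenerate intervals, having disjoint interiors
   means that one of the two lies to the left of the other. *)
Definition tagged_partition (D : seq tagged_interval) : Prop :=
  [/\ all (fun c => (sval (left_end c) < sval (right_end c)) &&
                    (sval (left_end c) <= sval (tag_point c)
                       <= sval (right_end c))) D,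
      pairwise (fun c c' => (sval (right_end c) <= sval (left_end c')) ||
                            (sval (right_end c') <= sval (left_end c))) D
    & forall x : I,
        has (fun c => sval (left_end c) <= sval x <= sval (right_end c)) D].

Definition delta_fine (delta : I -> R) (D : seq tagged_interval) : Prop :=
  all (fun c =>
    (sval (tag_point c) - delta (tag_point c) < sval (left_end c)) &&
    (sval (right_end c) < sval (tag_point c) + delta (tag_point c))) D.

Definition fine_partitions (delta : I -> R) : set (seq tagged_interval) :=
  [set D | tagged_partition D /\ delta_fine delta D].

End partitions.

Arguments tagged_interval {R} a b.

Section integrability.
Context {R : realType} {a b : R} {X : preTopologicalLmodType R}.
Local Notation I := (interval_type a b).

Definition upper_mean (p : R) (rho : X -> R) (f : I -> X) : \bar R :=
  ereal_inf [set ereal_sup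
      [set (\sum_(c <- D) rho (f (tag_point c)) `^ p * tagged_width c)%:E
         | D in fine_partitions delta]
    | delta in is_gauge].

(* Meaningful where [upper_mean p rho f] is finite, as it is on U^p. *)
Definition U_seminorm (p : R) (rho : X -> R) (f : I -> X) : R :=
  fine (upper_mean p rho f) `^ p^-1.

Definition U_functions (p : R) : set (I -> X) :=
  [set f | forall rho : X -> R, continuous_seminorm rho ->
             (upper_mean p rho f < +oo)%E].

Definition SKH_integrable (rho : X -> R) (f : I -> X) : Prop :=
  exists F : I -> X, forall e : R, 0 < e ->
    exists2 delta : I -> R, is_gauge delta &
      forall D, fine_partitions delta D ->
        \sum_(c <- D) rho (F (right_end c) - F (left_end c)
                           - tagged_width c *: f (tag_point c)) < e.

Definition KH_integrable (g : I -> R) : Prop :=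
  exists z : R, forall e : R, 0 < e ->
    exists2 delta : I -> R, is_gauge delta &
      forall D, fine_partitions delta D ->
        `|\sum_(c <- D) g (tag_point c) * tagged_width c - z| < e.

Definition L_integrable (p : R) (rho : X -> R) (f : I -> X) : Prop :=
  SKH_integrable rho f /\ KH_integrable (fun t => rho (f t) `^ p).

Definition L_functions (p : R) : set (I -> X) :=
  [set f | forall rho : X -> R, continuous_seminorm rho ->
             L_integrable p rho f].

Lemma upper_mean_ltyP (p : R) (rho : X -> R) (f : I -> X) :
  (upper_mean p rho f < +oo)%E <->
  exists2 delta : I -> R, is_gauge delta & exists M : R,
    forall D, fine_partitions delta D ->
      \sum_(c <- D) rho (f (tag_point c)) `^ p * tagged_width c <= M.
Proof.
split.
- move=> /ereal_inf_lt[_ [delta gd <-]] supy; exists delta => //.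
  set s := ereal_sup _ in supy.
  have [D0|] := pselect (exists D, fine_partitions delta D); last first.
    by move=> nD; exists 0 => D DP; exfalso; apply: nD; exists D.
  exists (fine s) => D DP.
  have les : ((\sum_(c <- D) rho (f (tag_point c)) `^ p * tagged_width c)%:E
               <= s)%E.
    by apply: ereal_sup_ubound; exists D.
  rewrite -lee_fin fineK// fin_numE; apply/andP; split.
    by apply/eqP => sE; rewrite sE leeNy_eq in les.
  by apply/eqP => sE; rewrite sE ltxx in supy.
- move=> [delta gd [M MP]].
  apply: (@le_lt_trans _ _ M%:E); last exact: ltry.
  apply: le_trans (_ : ereal_sup [set (\sum_(c <- D)
      rho (f (tag_point c)) `^ p * tagged_width c)%:E
        | D in fine_partitions delta] <= _)%E.
    by apply: ereal_inf_lbound; exists delta.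
  by apply: ge_ereal_sup => _ [D DP <-]; rewrite lee_fin MP.
Qed.

Lemma tagged_partition_width (D : seq (tagged_interval a b)) :
  tagged_partition D -> all (fun c => 0 <= tagged_width c) D.
Proof.
by move=> [+ _ _]; apply: sub_all => c /andP[lc _]; rewrite subr_ge0 ltW.
Qed.

Lemma delta_fine_le (d d' : I -> R) (D : seq (tagged_interval a b)) :
  (forall t, d t <= d' t) -> delta_fine d D -> delta_fine d' D.
Proof.
move=> dd'; apply: sub_all => c /andP[c1 c2]; apply/andP; split.
  by apply: le_lt_trans c1; rewrite lerB.
by apply: (lt_le_trans c2); rewrite lerD.
Qed.

Lemma ler_sum_all (T : Type) (P : pred T) (s : seq T) (F G : T -> R) :
  all P s -> (forall x, P x -> F x <= G x) ->
  \sum_(x <- s) F x <= \sum_(x <- s) G x.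
Proof.
move=> + FG; elim: s => [|x s IH]; first by rewrite !big_nil.
by move=> /= /andP[Px Ps]; rewrite !big_cons lerD ?FG ?IH.
Qed.

Lemma powRD_le (p x y : R) : 0 <= p -> 0 <= x -> 0 <= y ->
  (x + y) `^ p <= 2 `^ p * (x `^ p + y `^ p).
Proof.
move=> p0 x0 y0; wlog xy : x y x0 y0 / x <= y => [wl|].
  have [/wl->//|/ltW yx] := leP x y.
  by rewrite addrC [in leRHS]addrC wl.
apply: (@le_trans _ _ ((2 * y) `^ p)).
  by rewrite ge0_ler_powR ?nnegrE ?addr_ge0 ?mulr_ge0// mulr_natl mulr2n lerD2r.
by rewrite powRM// ler_wpM2l ?powR_ge0// lerDr powR_ge0.
Qed.

Lemma U_functions_submod_closed (p : R) (hp : 1 <= p) :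
  submod_closed [in U_functions p].
Proof.
have p0 : 0 <= p by apply: le_trans hp.
split.
  apply/mem_set => rho [[r0 rD rZ] _]; apply/upper_mean_ltyP.
  exists (fun=> 1); first by move=> t; exact: ltr01.
  exists 0 => D _; rewrite big1// => c _.
  have -> : rho ((0 : I -> X) (tag_point c)) = 0.
    transitivity (rho (0 *: (0 : X))); first by rewrite scale0r.
    by rewrite rZ normr0 mul0r.
  by rewrite powR0 ?mul0r// gt_eqF// (lt_le_trans _ hp).
move=> k f g /set_mem fU /set_mem gU; apply/mem_set => rho hrho.
apply/upper_mean_ltyP.
have [d1 gd1 [M1 h1]] := (upper_mean_ltyP _ _ _).1 (fU _ hrho).
have [d2 gd2 [M2 h2]] := (upper_mean_ltyP _ _ _).1 (gU _ hrho).
have [[r0 rD rZ] _] := hrho.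
exists (fun t => Num.min (d1 t) (d2 t)).
  by move=> t; rewrite lt_min gd1 gd2.
exists (2 `^ p * (`|k| `^ p * M1 + M2)) => D [DP Dfine].
have fine1 : delta_fine d1 D.
  by apply: delta_fine_le Dfine => t; rewrite ge_min lexx.
have fine2 : delta_fine d2 D.
  by apply: delta_fine_le Dfine => t; rewrite ge_min lexx orbT.
have {}h1 := h1 D (conj DP fine1); have {}h2 := h2 D (conj DP fine2).
apply: (@le_trans _ _ (2 `^ p * (`|k| `^ p *
    (\sum_(c <- D) rho (f (tag_point c)) `^ p * tagged_width c) +
    \sum_(c <- D) rho (g (tag_point c)) `^ p * tagged_width c))); last first.
  by rewrite ler_wpM2l ?powR_ge0// lerD// ler_wpM2l ?powR_ge0.
rewrite mulr_sumr -big_split/= mulr_sumr.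
apply: (ler_sum_all (tagged_partition_width DP)) => c lc.
rewrite mulrA -mulrDl mulrA ler_wpM2r//.
apply: (@le_trans _ _ ((`|k| * rho (f (tag_point c)) +
                        rho (g (tag_point c))) `^ p)).
  rewrite ge0_ler_powR ?nnegrE ?addr_ge0 ?mulr_ge0//.
  by rewrite -rZ; exact: rD.
by rewrite -powRM//; apply: powRD_le; rewrite ?mulr_ge0.
Qed.

End integrability.

Definition U_space (R : realType) (a b : R) (X : preTopologicalLmodType R)
    (rho : nat -> X -> R) (p : R) (hp : 1 <= p) : Type :=
  seminormed (fun (i : nat)
    (f : linear_subspace (@U_functions_submod_closed R a b X p hp)) =>
      U_seminorm p (rho i) (\val f)).

HB.instance Definition _ (R : realType) (a b : R)
    (X : preTopologicalLmodType R) (rho : nat -> X -> R) (p : R)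
    (hp : 1 <= p) :=
  PreTopologicalLmodule.copy (U_space a b rho hp) (seminormed (fun (i : nat)
    (f : linear_subspace (@U_functions_submod_closed R a b X p hp)) =>
      U_seminorm p (rho i) (\val f))).

Definition U_fun (R : realType) (a b : R) (X : preTopologicalLmodType R)
    (rho : nat -> X -> R) (p : R) (hp : 1 <= p) (f : U_space a b rho hp)
  : interval_type a b -> X :=
  \val (f : linear_subspace (@U_functions_submod_closed R a b X p hp)).

(* As a set of elements of [U_space]; that every function in [L_functions] is in
   [U_functions], so that none is lost, has to be proved separately. *)
Definition L_space (R : realType) (a b : R) (X : preTopologicalLmodType R)
    (rho : nat -> X -> R) (p : R) (hp : 1 <= p) : set (U_space a b rho hp) :=
  [set f | L_functions p (U_fun f)].

Arguments L_space {R} a b {X} rho {p} hp.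

(* Main.v *)
(* For f strongly Henstock integrable with primitive F, tangents of x^p compare
   the Riemann sums of rho(f)^p with the Riesz sums
   sum rho(F v - F u)^p / (v - u)^(p - 1), which have a finite supremum as soon
   as f lies in U^p; this supremum is then the integral of rho(f)^p. Hence L^p
   consists of the elements of U^p that are rho-SKH integrable for every rho, and
   is a subspace. By sequential completeness of X, one primitive serves for all
   semi-norms; the primitives of a convergent sequence in L^p converge pointwise,
   with control of the variation of the difference, so that L^p is closed.
   Completeness of U^p is the Riesz-Fischer argument: countable subadditivity of
   the upper mean shows that a fast Cauchy sequence converges outside a set which
   no upper mean sees. The quotient by the null space is then complete and
   separated. *)
From HB Require Import structures.
Require Import Defs.
From mathcomp Require Import all_boot all_order all_algebra.
From mathcomp Require Import all_classical all_reals all_analysis.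
From mathcomp Require Import ring lra.

Set Implicit Arguments.
Unset Strict Implicit.
Unset Printing Implicit Defensive.

Import Order.TTheory GRing.Theory Num.Theory.
Import numFieldNormedType.Exports.

Local Open Scope classical_set_scope.
Local Open Scope ring_scope.

(** The obstacle is that a tangent of [x ^ p] at [q (h t)] has slope [p * q (h t) ^ (p - 1)],
    unbounded in the tag, while a primitive only makes the total of the defects small.
    [countable_glue] removes it: countably many gauges, the [k]-th with a budget such as
    [e / 2 ^+ k.+1], are merged into one, and each tag draws on as many of them as it needs.
    Countable subadditivity of the upper mean is another instance of the same lemma, so the
    integrability of the powers and the completeness argument rest on one device. The reverse
    inequality uses the slopes of a fixed partition, which are finitely many; there the difficulty
    is that fine chains do not respect its division points. A gauge that forces these points to be
    tags permits cutting there. The upper mean is subadditive but not additive, so Hölder's and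
    Minkowski's inequalities are replaced by pointwise ones, such as [z <= 1 + z ^ p] and the
    convexity of [x ^ p], whose two sides are averaged. *)

(** * Tagged partitions as ordered chains of cells *)

Lemma pairwise_to_rem (T : eqType) (r : rel T) (x : T) (s : seq T) :
  symmetric r -> x \in s -> pairwise r s -> pairwise r (x :: rem x s).
Proof.
move=> rsym xs rs; rewrite pairwise_cons (subseq_pairwise (rem_subseq x s))// andbT.
elim: s xs rs => //= y s IH; rewrite in_cons => /predU1P[->|xs] /andP[ys rs].
  by rewrite eqxx.
case: eqP => [<-//|_]; rewrite /= IH// andbT rsym.
exact: (allP ys).
Qed.

Section chains.
Context {R : realType} {a b : R}.
Local Notation I := (interval_type a b).
Local Notation cell := (tagged_interval a b).

HB.instance Definition _ := gen_eqMixin cell.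

Lemma interval_type_inj (x y : I) : sval x = sval y -> x = y.
Proof. by move: x y => [x hx] [y hy] /= xy; exact: eq_exist. Qed.

(** The unordered collections of [tagged_partition] are replaced by lists of cells in increasing
    order: these can be concatenated, telescoped and treated by induction, and the end points [u]
    and [v] give access to subintervals. *)
Fixpoint chain (u v : I) (s : seq cell) : Prop :=
  if s is c :: s' then
    [/\ left_end c = u, sval u < sval (right_end c),
        sval u <= sval (tag_point c) <= sval (right_end c)
      & chain (right_end c) v s']
  else u = v.

Lemma chain_le u v s : chain u v s -> sval u <= sval v.
Proof.
elim: s u => [u ->//|c s IH u [_ uc _ /IH]]; exact/le_trans/ltW.
Qed.

Lemma chain_cat u w v s1 s2 : chain u w s1 -> chain w v s2 ->
  chain u v (s1 ++ s2).
Proof.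
move=> + h2; elim: s1 u => [u ->//|c s IH u /= [-> uc tc /IH ?]]; split => //.
Qed.

Lemma chain_width_ge0 u v s : chain u v s -> all (fun c => 0 <= tagged_width c) s.
Proof.
elim: s u => // c s IH u /= [uE uc _ /IH ->]; rewrite andbT.
by rewrite /tagged_width uE subr_ge0 ltW.
Qed.

Lemma chain_width_gt0 u v s : chain u v s -> all (fun c => 0 < tagged_width c) s.
Proof.
elim: s u => // c s IH u /= [uE uc _ /IH ->]; rewrite andbT.
by rewrite /tagged_width uE subr_gt0.
Qed.

Lemma chain_left_ge u v s : chain u v s ->
  all (fun c => sval u <= sval (left_end c)) s.
Proof.
elim: s u => // c s IH u /= [-> uc _ /IH h]; rewrite lexx/=.
by apply: sub_all h => d; apply/le_trans/ltW.
Qed.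

Lemma chain_partition_of u v s : chain u v s ->
  [/\ all (fun c => (sval (left_end c) < sval (right_end c)) &&
                    (sval (left_end c) <= sval (tag_point c)
                       <= sval (right_end c))) s,
      pairwise (fun c c' => (sval (right_end c) <= sval (left_end c')) ||
                            (sval (right_end c') <= sval (left_end c))) s
    & forall x : I, sval u < sval v -> sval u <= sval x <= sval v ->
        has (fun c => sval (left_end c) <= sval x <= sval (right_end c)) s].
Proof.
elim: s u => [u ->|c s IH u /= [-> uc tc cs]].
  by split => // x; rewrite ltxx.
have [h1 h2 h3] := IH _ cs.
split; rewrite ?uc ?tc ?h1 ?h2 ?andbT//=.
  by apply: sub_all (chain_left_ge cs) => d ->.
move=> x uv /andP[ux xv]; rewrite ux/=.
have [//|cx] := leP; rewrite h3//; last by rewrite ltW.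
exact: lt_le_trans cx xv.
Qed.

Lemma sum_telescope (V : zmodType) u v s (F : I -> V) : chain u v s ->
  \sum_(c <- s) (F (right_end c) - F (left_end c)) = F v - F u.
Proof.
elim: s u => [u ->|c s IH u /= [uE uc tc /IH]]; first by rewrite big_nil subrr.
by rewrite big_cons uE => ->; rewrite addrC addrA subrK.
Qed.

Lemma sum_width u v s : chain u v s ->
  \sum_(c <- s) tagged_width c = sval v - sval u.
Proof. exact: (@sum_telescope R u v s sval). Qed.

(** The cell that covers [u] to its right must start at [u]; disjointness puts all others beyond its
    right end point, where the induction on the size goes on. Half-open cells in the covering
    hypothesis ensure that a next cell is found. *)
Lemma partition_chain_of u v (s : seq cell) :
  all (fun c => (sval (left_end c) < sval (right_end c)) &&
                    (sval (left_end c) <= sval (tag_point c)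
                       <= sval (right_end c))) s ->
  all (fun c => (sval u <= sval (left_end c)) && (sval (right_end c) <= sval v)) s ->
  pairwise (fun c c' => (sval (right_end c) <= sval (left_end c')) ||
                            (sval (right_end c') <= sval (left_end c))) s ->
  (forall x : I, sval u <= sval x < sval v ->
     has (fun c => sval (left_end c) <= sval x < sval (right_end c)) s) ->
  sval u <= sval v ->
  exists2 s', perm_eq s s' & chain u v s'.
Proof.
have [n] := ubnP (size s); elim: n u s => // n IH u s sn h1 h2 h3 h4.
rewrite le_eqVlt => /predU1P[/interval_type_inj uv|uv].
  subst v; exists s => //=; case: s h1 h2 {sn h3 h4} => //= c s.
  move=> /andP[/andP[c1 _] _] /andP[/andP[c2 c3] _].
  by have := lt_le_trans c1 (le_trans c3 c2); rewrite ltxx.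
have /hasP[c cs /andP[cl cr]] := h4 u ltac:(by rewrite lexx).
have /andP[cl' crv] := allP h2 _ cs.
have cE : left_end c = u by apply/interval_type_inj/le_anti/andP.
have /andP[c12 ctag] := allP h1 _ cs.
have psym : symmetric (fun c c' : cell =>
  (sval (right_end c) <= sval (left_end c')) ||
  (sval (right_end c') <= sval (left_end c))) by move=> x y; rewrite orbC.
have ps := perm_to_rem cs.
have : pairwise (fun c c' : cell => (sval (right_end c) <= sval (left_end c')) ||
  (sval (right_end c') <= sval (left_end c))) (c :: rem c s).
  exact: pairwise_to_rem.
rewrite pairwise_cons => /andP[/allP hc hp].
have rs d : d \in rem c s -> d \in s by move/mem_rem.
have [] := IH (right_end c) (rem c s).
- by rewrite size_rem//; case: (s) cs sn.
- by apply/allP => d /rs; exact: (allP h1).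
- apply/allP => d dr; have /andP[ud ->] := allP h2 _ (rs _ dr); rewrite andbT.
  have /orP[//|] := hc _ dr; rewrite cE => du.
  have /andP[+ _] := allP h1 _ (rs _ dr).
  by move/lt_le_trans/(_ (le_trans du ud)); rewrite ltxx.
- exact: hp.
- move=> x /andP[cx xv].
  have : has (fun d => sval (left_end d) <= sval x < sval (right_end d)) (c :: rem c s).
    by rewrite -(perm_has _ ps); apply: h4; rewrite xv andbT (le_trans _ cx)// ltW.
  by rewrite /= [X in X || _](_ : _ = false)// ltNge cx andbF.
- exact: crv.
- move=> s' p1 p2; exists (c :: s'); last by rewrite -cE.
  by apply: perm_trans ps _; rewrite perm_cons.
Qed.

(* A point [x < v] lies in a cell also to its right: apply the covering
   property between [x] and the next end point. *)
Lemma cover_right (v : I) (s : seq cell) :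
  (forall x : I, has (fun c => sval (left_end c) <= sval x <= sval (right_end c)) s) ->
  forall x : I, sval x < sval v ->
     has (fun c => sval (left_end c) <= sval x < sval (right_end c)) s.
Proof.
move=> cov x xv.
have [y [xy yv hy]] : exists y : R, [/\ sval x < y, y <= sval v &
   forall c, c \in s -> sval x < sval (left_end c) -> y <= sval (left_end c)].
  elim: s {cov} => [|c s [y [xy yv IH]]]; first by exists (sval v).
  have [cx|xc] := leP (sval (left_end c)) (sval x).
    exists y; split => // d; rewrite in_cons => /predU1P[->|/IH//].
    by rewrite ltNge cx.
  exists (Num.min y (sval (left_end c))); split.
  - by rewrite lt_min xy xc.
  - by rewrite ge_min yv.
  - move=> d; rewrite in_cons ge_min => /predU1P[->|/IH h /h ->//].
    by rewrite lexx orbT.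
have zab : (sval x + y) / 2 \in `[a, b].
  have /andP[ax xb] := svalP x; have /andP[av vb] := svalP v.
  rewrite in_itv/=; move: ax xb av vb; rewrite !bnd_simp => ax xb av vb.
  by apply/andP; split; lra.
have /hasP[c cs /= /andP[cz zc]] := cov (exist (fun x => x \in `[a, b]) _ zab).
apply/hasP; exists c => //; apply/andP; split; last by lra.
by rewrite leNgt; apply/negP => /(hy _ cs) yc; lra.
Qed.

End chains.

(** * Cousin's lemma, refinement and cutting of fine chains *)

Section fine_chains.
Context {R : realType} {a b : R}.
Local Notation I := (interval_type a b).
Local Notation cell := (tagged_interval a b).

Definition riemann_sum (g : I -> R) (s : seq cell) : R :=
  \sum_(c <- s) g (tag_point c) * tagged_width c.

Lemma delta_fine_cat (d : I -> R) (s1 s2 : seq cell) :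
  delta_fine d s1 -> delta_fine d s2 -> delta_fine d (s1 ++ s2).
Proof. by rewrite /delta_fine all_cat => -> ->. Qed.

Lemma riemann_sum_cat g (s1 s2 : seq cell) :
  riemann_sum g (s1 ++ s2) = riemann_sum g s1 + riemann_sum g s2.
Proof. exact: big_cat. Qed.

Lemma mem_interval (u v : I) (x : R) :
  sval u <= x -> x <= sval v -> x \in `[a, b].
Proof.
move: u v => [u /=]; rewrite in_itv/= => /andP[au _] [v /=].
rewrite in_itv/= => /andP[_ vb] ux xv.
by rewrite in_itv/= (le_trans au ux) (le_trans xv vb).
Qed.

(** The supremum of the points reachable from [u] by a fine chain is itself reached, by a cell
    tagged at it; were it less than [v], one more cell with the same tag would pass it. *)
Lemma cousin (d : I -> R) (u v : I) : is_gauge d -> sval u <= sval v ->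
  exists2 s, chain u v s & delta_fine d s.
Proof.
move=> d0 uv.
pose S := [set r | exists w : I, [/\ sval w = r, sval w <= sval v &
  exists2 s, chain u w s & delta_fine d s]].
have Su : S (sval u) by exists u; split => //; exists [::].
have Sv : has_sup S.
  by split; [exists (sval u) | exists (sval v) => _ [w [<-]]].
have uc : sval u <= sup S by apply: sup_upper_bound.
have cv : sup S <= sval v.
  by apply: ge_sup => [|_ [w [<-]]//]; exists (sval u).
pose c : I := exist (fun x => x \in `[a, b]) _ (mem_interval uc cv).
have [s sc sd] : exists2 s, chain u c s & delta_fine d s.
  have [_ [w [<- wv [s sw sd]]] wc] := sup_adherent (d0 c) Sv.
  have : sval w <= sup S by apply: sup_upper_bound => //; exists w; split => //; exists s.
  rewrite le_eqVlt => /predU1P[wE|wc'].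
    by exists s => //; have -> : c = w by apply: interval_type_inj.
  exists (s ++ [:: TaggedInterval w c c]).
    by apply: chain_cat sw _; split => //=; rewrite lexx (ltW wc').
  by apply: delta_fine_cat => //; rewrite /delta_fine/= andbT ltrDl d0 wc.
have [cv'|vc] := ltP (sval c) (sval v); last first.
  by exists s => //; have <- : c = v by apply/interval_type_inj/le_anti/andP.
(* Half of [d c] keeps the new end point strictly inside the gauge interval. *)
pose y := Num.min (sval v) (sval c + d c / 2).
have cy : sval c < y.
  by rewrite lt_min cv' ltrDl divr_gt0.
have yv : y <= sval v by rewrite ge_min lexx.
pose e : I := exist (fun x => x \in `[a, b]) _ (mem_interval (ltW cy) yv).
suff : sval e <= sup S by rewrite leNgt cy.
apply: sup_upper_bound => //; exists e; split => //.
exists (s ++ [:: TaggedInterval c e c]).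
  by apply: chain_cat sc _; split => //; rewrite /= lexx (ltW cy).
apply: delta_fine_cat => //; rewrite /delta_fine/= andbT -[sup S]/(sval c).
have dc := d0 c; have : y <= sval c + d c / 2 by rewrite ge_min lexx orbT.
by move=> yc; apply/andP; split; lra.
Qed.

(** Cells outside [P] are replaced by fine chains from Cousin's lemma, which only add non-negative
    terms. An estimate known for complete fine chains thereby passes to any fine part of a chain. *)
Lemma refine_chain (d : I -> R) (P : pred cell) (u v : I) (s : seq cell) :
  is_gauge d -> chain u v s -> delta_fine d [seq c <- s | P c] ->
  exists s', [/\ chain u v s', delta_fine d s' &
    forall G : cell -> R, (forall c, 0 <= tagged_width c -> 0 <= G c) ->
      \sum_(c <- s | P c) G c <= \sum_(c <- s') G c].
Proof.
move=> d0; elim: s u => [u /= <- _|c s IH u /= [cu uc tc cs] cf].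
  by exists [::]; split => // G _; rewrite !big_nil.
case: ifP cf => [Pc /= /andP[cf sf]|Pc sf].
  have [s' [cs' fs' hs']] := IH _ cs sf.
  exists (c :: s'); split => //; first by rewrite /delta_fine/= cf fs'.
  by move=> G G0; rewrite !big_cons Pc lerD// hs'.
have [s' [cs' fs' hs']] := IH _ cs sf.
have [t ct ft] := cousin d0 (ltW uc).
exists (t ++ s'); split; first exact: chain_cat cs'.
  exact: delta_fine_cat.
move=> G G0; rewrite big_cons Pc big_cat/= ler_wpDl ?hs'//.
by rewrite big_seq sumr_ge0// => x /(allP (chain_width_ge0 ct)) /G0.
Qed.

Lemma chain_subadd (phi : I -> I -> R) (u v : I) (s : seq cell) :
  (forall x, phi x x <= 0) ->
  (forall x y z, phi x z <= phi x y + phi y z) ->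
  chain u v s -> phi u v <= \sum_(c <- s) phi (left_end c) (right_end c).
Proof.
move=> phi0 phiD; elim: s u => [u /= <-|c s IH u /= [cu uc tc /IH h]].
  by rewrite big_nil.
by rewrite big_cons cu (le_trans (phiD _ (right_end c) _))// lerD2l.
Qed.

(** Subdividing each cell does not decrease a subadditive sum, so a bound on fine chains holds on
    all chains, however coarse. *)
Lemma refine_subadd (phi : I -> I -> R) (d : I -> R) (u v : I) (s : seq cell) :
  (forall x, phi x x <= 0) ->
  (forall x y z, phi x z <= phi x y + phi y z) ->
  is_gauge d -> chain u v s ->
  exists s', [/\ chain u v s', delta_fine d s' &
    \sum_(c <- s) phi (left_end c) (right_end c) <=
    \sum_(c <- s') phi (left_end c) (right_end c)].
Proof.
move=> phi0 phiD d0; elim: s u => [u /= <-|c s IH u /= [cu uc tc cs]].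
  by exists [::]; split => //; rewrite !big_nil.
have [s' [cs' fs' hs']] := IH _ cs.
have [t ct ft] := cousin d0 (ltW uc).
exists (t ++ s'); split; first exact: chain_cat cs'.
  exact: delta_fine_cat.
by rewrite big_cons big_cat/= cu lerD// chain_subadd.
Qed.

(* A cell of a fine chain containing [w] in its interior has tag [w], so it can
   be cut at [w] without changing any Riemann sum. *)
Lemma split_chain (d : I -> R) (u w v : I) (s : seq cell) :
  (forall t, t != w -> d t <= `|sval w - sval t|) ->
  sval u <= sval w -> sval w <= sval v -> chain u v s -> delta_fine d s ->
  exists s1 s2, [/\ chain u w s1, chain w v s2, delta_fine d s1, delta_fine d s2 &
    forall g, riemann_sum g s = riemann_sum g s1 + riemann_sum g s2].
Proof.
move=> dw; elim: s u => [u uw + uv _|c s IH u uw wv /= [cu uc tc cs] /andP[cf sf]].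
  rewrite -uv => wu; exists [::], [::].
  have -> : w = u by apply/interval_type_inj/le_anti/andP.
  by split => // g; rewrite /riemann_sum !big_nil addr0.
have [rw|wr] := leP (sval (right_end c)) (sval w).
  have [s1 [s2 [h1 h2 h3 h4 h5]]] := IH _ rw wv cs sf.
  exists (c :: s1), s2; split => //; first by rewrite /delta_fine/= cf h3.
  by move=> g; rewrite /riemann_sum !big_cons -addrA -!/(riemann_sum _ _) h5.
move: uw; rewrite le_eqVlt => /predU1P[/interval_type_inj uE|uw].
  subst w; exists [::], (c :: s); split => //; first by rewrite /delta_fine/= cf.
  by move=> g; rewrite /riemann_sum big_nil add0r.
have tw : tag_point c = w.
  apply/eqP/contraT => /dw; rewrite leNgt => /negP; case.
  move: cf; rewrite cu => /andP[c1 c2]; rewrite real_ltr_norml ?num_real//.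
  by apply/andP; split; lra.
exists [:: TaggedInterval u w w], (TaggedInterval w (right_end c) w :: s).
move: cf; rewrite cu tw => /andP[c1 c2].
split => //=; first by split => //; rewrite lexx (ltW uw).
- by split => //; rewrite lexx (ltW wr).
- rewrite /delta_fine/= andbT; apply/andP; split => //; lra.
- rewrite /delta_fine/=; apply/andP; split => //; apply/andP; split => //; lra.
- move=> g; rewrite /riemann_sum !big_cons big_nil addr0 tw addrA -mulrDr.
  by congr (_ * _ + _); rewrite /tagged_width cu/=; ring.
Qed.

End fine_chains.

(** * The filter of fine chains and the gluing of gauges *)

Section fine_filter.
Context {R : realType} {a b : R} (hab : a < b).
Local Notation I := (interval_type a b).
Local Notation cell := (tagged_interval a b).

Let a_in : a \in `[a, b]. Proof. by rewrite in_itv/= lexx ltW. Qed.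
Let b_in : b \in `[a, b]. Proof. by rewrite in_itv/= lexx ltW. Qed.

Definition lower_end : I := exist (fun x => x \in `[a, b]) a a_in.
Definition upper_end : I := exist (fun x => x \in `[a, b]) b b_in.

Lemma lower_end_le (x : I) : sval lower_end <= sval x.
Proof. by case: x => x /=; rewrite in_itv => /andP[]. Qed.

Lemma upper_end_ge (x : I) : sval x <= sval upper_end.
Proof. by case: x => x /=; rewrite in_itv => /andP[]. Qed.

(** Kurzweil--Henstock limits are limits along this filter, so that gauges can be handled through
    [near]. Its properness is Cousin's lemma. *)
Definition fine_chains : set_system (seq cell) :=
  [set P | exists2 d, is_gauge d &
     forall s, chain lower_end upper_end s -> delta_fine d s -> P s].

Lemma gauge_min (d1 d2 : I -> R) : is_gauge d1 -> is_gauge d2 ->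
  is_gauge (fun t => Num.min (d1 t) (d2 t)).
Proof. by move=> h1 h2 t; rewrite lt_min h1 h2. Qed.

Lemma delta_fine_minl (d1 d2 : I -> R) s :
  delta_fine (fun t => Num.min (d1 t) (d2 t)) s -> delta_fine d1 s.
Proof. by apply: delta_fine_le => t; rewrite ge_min lexx. Qed.

Lemma delta_fine_minr (d1 d2 : I -> R) s :
  delta_fine (fun t => Num.min (d1 t) (d2 t)) s -> delta_fine d2 s.
Proof. by apply: delta_fine_le => t; rewrite ge_min lexx orbT. Qed.

Global Instance fine_chains_filter : ProperFilter fine_chains.
Proof.
apply: Build_ProperFilter_ex => [P [d d0 dP]|].
  have [s cs fs] := cousin d0 (lower_end_le upper_end).
  by exists s; exact: dP.
split.
- by exists (fun=> 1) => // t; rewrite ltr01.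
- move=> P Q [d1 d10 h1] [d2 d20 h2].
  exists (fun t => Num.min (d1 t) (d2 t)); first exact: gauge_min.
  move=> s cs fs; split; first exact: h1 cs (delta_fine_minl fs).
  exact: h2 cs (delta_fine_minr fs).
- by move=> P Q PQ [d d0 dP]; exists d => // s cs fs; apply/PQ/dP.
Qed.

Lemma chain_fine_chains (P : set (seq cell)) :
  (forall s, chain lower_end upper_end s -> P s) -> fine_chains P.
Proof. by move=> h; exists (fun=> 1) => [t|s cs _]; [exact: ltr01|exact: h]. Qed.

Lemma near_chain : \forall s \near fine_chains, chain lower_end upper_end s.
Proof. exact: chain_fine_chains. Qed.

Lemma chain_partition s : chain lower_end upper_end s -> tagged_partition s.
Proof.
move=> cs; have [h1 h2 h3] := chain_partition_of cs; split => // x.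
by apply: h3 => //; rewrite lower_end_le upper_end_ge.
Qed.

Lemma partition_chain D : tagged_partition D ->
  exists2 s, perm_eq D s & chain lower_end upper_end s.
Proof.
move=> [h1 h2 h3]; apply: partition_chain_of => //; last exact: ltW.
- by apply: sub_all h1 => c _; rewrite lower_end_le upper_end_ge.
- by move=> x /andP[_]; exact: cover_right.
Qed.

(** Sorting a partition only permutes its cells; invariance under permutation is thus what allows
    the passage between partitions and chains. *)
Lemma fine_partitions_near (P : set (seq cell)) :
  (forall D s, perm_eq D s -> P s -> P D) ->
  (exists2 d, is_gauge d & forall D, fine_partitions d D -> P D) <->
  fine_chains P.
Proof.
move=> permP; split=> -[d d0 dP]; exists d => //.
  by move=> s cs fs; apply: dP; split => //; exact: chain_partition.
move=> D [/partition_chain[s Ds cs] fD]; apply: (permP _ _ Ds); apply: dP cs _.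
by rewrite /delta_fine -(perm_all _ Ds).
Qed.

(* The gauge at [t] is the minimum of the first [J t] given gauges: the cells
   with [k < J (tag_point c)] are then fine for the [k]-th gauge, and by
   Cousin's lemma they are part of a complete fine chain. *)
Lemma countable_glue (G : nat -> cell -> R) (e : nat -> R) (J : I -> nat) (B : R) :
  (forall k c, 0 <= tagged_width c -> 0 <= G k c) ->
  (forall k, \forall s \near fine_chains, \sum_(c <- s) G k c <= e k) ->
  (forall n, \sum_(k < n) e k <= B) ->
  \forall s \near fine_chains,
    \sum_(c <- s) \sum_(k < J (tag_point c)) G k c <= B.
Proof.
move=> G0 hG eB.
have /choice[d hd] : forall k, exists d, is_gauge d /\
  forall s, chain lower_end upper_end s -> delta_fine d s -> \sum_(c <- s) G k c <= e k.
  by move=> k; have [d d0 h] := hG k; exists d.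
exists (fun t => \big[Order.min/1]_(k < J t) d k t).
  move=> t; elim/big_ind : _ => [|x y x0 y0|k _]; first exact: ltr01.
    by rewrite lt_min x0 y0.
  exact: (hd k).1.
move=> s cs fs.
(* The chain is finite, so one [M] bounds all [J (tag_point c)] and the double sum can be
   exchanged. *)
pose M := (\max_(c <- s) J (tag_point c))%N.
apply: le_trans (eB M).
under eq_big_seq => c cin.
  rewrite (big_ord_widen M (fun k => G k c)).
    over.
  exact: (@leq_bigmax_seq _ _ xpredT (fun c => J (tag_point c))).
under eq_bigr do rewrite big_mkcond/=.
rewrite exchange_big/=; apply: ler_sum => k _.
rewrite -big_mkcond/=.
have [d0 hdk] := hd k.
have fk : delta_fine (d k) [seq c <- s | (k < J (tag_point c))%N].
  rewrite /delta_fine all_filter; apply: sub_all fs => c /andP[c1 c2].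
  apply/implyP => kJ.
  have kd : \big[Order.min/1]_(i < J (tag_point c)) d i (tag_point c) <= d k (tag_point c).
    by have := bigmin_le_cond 1 (fun i : 'I_(J (tag_point c)) => d i (tag_point c))
         (isT : xpredT (Ordinal kJ)).
  by apply/andP; split; lra.
have [s' [cs' fs' hs']] := refine_chain d0 cs fk.
exact: le_trans (hs' _ (G0 k)) (hdk _ cs' fs').
Qed.

End fine_filter.

(** * Integrability of the powers of a function with a primitive *)

(** Young's inequality for [y] and [x ^ (p - 1)] with exponents [p] and [p / (p - 1)]. At [p = 1]
    the second exponent degenerates, and both sides equal [y]. *)
Lemma powR_tangent (R : realType) (p x y : R) : 1 <= p -> 0 <= x -> 0 <= y ->
  x `^ p + p * x `^ (p - 1) * (y - x) <= y `^ p.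
Proof.
move=> p1 x0 y0; move: (p1); rewrite le_eqVlt => /predU1P[<-|{}p1].
  by rewrite subrr powRr0 !powRr1// !mul1r subrKC.
have p0 : 0 < p by lra.
have q0 : 0 < p / (p - 1) by rewrite divr_gt0// subr_gt0.
have pq : p^-1 + (p / (p - 1))^-1 = 1 by field; apply/andP; split; lra.
have := conjugate_powR y0 (powR_ge0 x (p - 1)) p0 q0 pq.
rewrite -powRrM [(p - 1) * (p / (p - 1))](_ : _ = p); last by field; lra.
rewrite -(ler_pM2l p0) => h.
have xE := mulr_powRB1 x0 p0.
have -> : p * x `^ (p - 1) * (y - x) = p * (y * x `^ (p - 1)) - p * (x * x `^ (p - 1)) by ring.
rewrite xE.
have : p * (y `^ p / p + x `^ p / (p / (p - 1))) = y `^ p + (p - 1) * x `^ p.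
  by field; apply/andP; split; lra.
lra.
Qed.

Lemma sum_half_exp (R : realType) (e : R) (n : nat) : 0 <= e ->
  \sum_(k < n) e / 2 ^+ k.+1 <= e.
Proof.
move=> e0; suff -> : \sum_(k < n) e / 2 ^+ k.+1 = e - e / 2 ^+ n.
  by rewrite gerBl divr_ge0// exprn_ge0.
elim: n => [|n IH]; first by rewrite big_ord0 expr0 divr1 subrr.
rewrite big_ord_recr/= IH exprS.
by field; rewrite expf_eq0/= pnatr_eq0 andbF.
Qed.

Section power_integrable.
Context {R : realType} {a b : R} (hab : a < b) {X : lmodType R}.
Local Notation I := (interval_type a b).
Local Notation cell := (tagged_interval a b).
Local Notation fine_chains := (fine_chains hab).
Local Notation lo := (lower_end hab).
Local Notation hi := (upper_end hab).

Definition henstock_defect (q : X -> R) (f F : I -> X) (c : cell) : R :=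
  q (F (right_end c) - F (left_end c) - tagged_width c *: f (tag_point c)).

Definition henstock_primitive (q : X -> R) (f F : I -> X) : Prop :=
  forall e, 0 < e ->
    \forall s \near fine_chains, \sum_(c <- s) henstock_defect q f F c < e.

Definition KH_has_integral (g : I -> R) (z : R) : Prop :=
  forall e, 0 < e -> \forall s \near fine_chains, `|riemann_sum g s - z| < e.

(** A bound on the upper mean without infimum or extended reals: it holds when the upper mean of [g]
    is less than [M], and implies that it is at most [M]. *)
Definition mean_le (g : I -> R) (M : R) : Prop :=
  \forall s \near fine_chains, riemann_sum g s <= M.

Context (q : X -> R) (hq : seminorm q).

Lemma seminorm_ge0 x : 0 <= q x. Proof. by case: hq. Qed.

Lemma seminormD x y : q (x + y) <= q x + q y. Proof. by case: hq. Qed.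

Lemma seminormZ k x : q (k *: x) = `|k| * q x. Proof. by case: hq. Qed.

Lemma seminorm0 : q 0 = 0.
Proof. by rewrite -(scale0r 0) seminormZ normr0 mul0r. Qed.

Lemma seminormN x : q (- x) = q x.
Proof. by rewrite -scaleN1r seminormZ normrN1 mul1r. Qed.

Lemma seminormB x y : q (x - y) <= q x + q y.
Proof. by rewrite -[q y]seminormN seminormD. Qed.

Lemma seminorm_distC x y : q (x - y) = q (y - x).
Proof. by rewrite -seminormN opprB. Qed.

Lemma seminorm_triangle y x z : q (x - z) <= q (x - y) + q (y - z).
Proof. by rewrite -{1}(subrKA y) seminormD. Qed.

Context (p : R) (hp : 1 <= p) (h H : I -> X).

(** [Phi c] is the Riesz term [V c ^ p / tagged_width c ^ (p - 1)], written through the mean slope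
    [y c] so that tangents of [x ^ p] apply to it. *)
Let V (c : cell) := q (H (right_end c) - H (left_end c)).
Let y (c : cell) := V c / tagged_width c.
Let Phi (c : cell) := y c `^ p * tagged_width c.
Local Notation defect := (henstock_defect q h H).

Let p0 : 0 <= p. Proof. exact: le_trans hp. Qed.

Let defect_ge0 c : 0 <= defect c. Proof. exact: seminorm_ge0. Qed.

Let y_ge0 c : 0 < tagged_width c -> 0 <= y c.
Proof. by move=> w0; rewrite divr_ge0 ?seminorm_ge0// ltW. Qed.

Let V_le c : 0 < tagged_width c ->
  V c <= q (h (tag_point c)) * tagged_width c + defect c.
Proof.
move=> w0; rewrite mulrC -{1}(gtr0_norm w0) -seminormZ addrC.
rewrite /V -{1}(subrK (tagged_width c *: h (tag_point c))
  (H (right_end c) - H (left_end c))).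
exact: seminormD.
Qed.

Let le_V c : 0 < tagged_width c ->
  q (h (tag_point c)) * tagged_width c <= V c + defect c.
Proof.
move=> w0; rewrite mulrC -{1}(gtr0_norm w0) -seminormZ.
rewrite -{1}(subrKC (H (right_end c) - H (left_end c)) (_ *: _)).
by rewrite /henstock_defect seminorm_distC seminormD.
Qed.

(** The tangent at [q (h t)] bounds each Riemann term by [Phi c] plus [K t] times the defect. As [K]
    is unbounded, the defect is counted [J t > K t] times, and the gluing of gauges keeps the total
    below [e]. *)
Let upper_sum : henstock_primitive q h H -> forall e, 0 < e ->
  \forall s \near fine_chains,
    riemann_sum (fun t => q (h t) `^ p) s <= \sum_(c <- s) Phi c + e.
Proof.
move=> hH e e0.
pose K t := p * q (h t) `^ (p - 1).
pose J t := (Num.truncn (K t)).+1.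
have := @countable_glue _ _ _ hab (fun _ => defect) (fun k => e / 2 ^+ k.+1) J e
  (fun _ c _ => defect_ge0 c).
move=> /(_ _ (fun n => sum_half_exp n (ltW e0))).
have hk k : \forall s \near fine_chains, \sum_(c <- s) defect c <= e / 2 ^+ k.+1.
  have := hH (e / 2 ^+ k.+1); rewrite divr_gt0 ?exprn_gt0// => /(_ isT).
  by apply: filterS => s; exact: ltW.
move=> /(_ hk); apply: filterS2 (near_chain hab) => s cs hs.
apply: le_trans (lerD (lexx _) hs); rewrite -big_split/=.
apply: (ler_sum_all (chain_width_gt0 cs)) => c w0.
rewrite sumr_const card_ord -[X in _ <= _ + X]mulr_natl.
have qh0 := seminorm_ge0 (h (tag_point c)).
have K0 : 0 <= K (tag_point c) by rewrite mulr_ge0 ?powR_ge0.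
apply: le_trans (_ : Phi c + K (tag_point c) * defect c <= _); last first.
  by rewrite lerD2l ler_wpM2r// ltW// truncnS_gt.
have := powR_tangent hp qh0 (y_ge0 w0); rewrite -/(K _).
rewrite -(ler_pM2r w0) -/(Phi c) mulrDl -mulrA [(y c - _) * _]mulrBl mulfVK ?gt_eqF//.
have := ler_wpM2l K0 (le_V w0); rewrite -/(V c) mulrDr mulrBr; lra.
Qed.

(** Jensen's inequality up to defects: the tangent is taken at the mean slope [y c], the same for
    all cells of [s], and its linear part is controlled because [V c] is at most the sum of the
    increments over [s]. *)
Let cell_le u v (c : cell) s :
  left_end c = u -> right_end c = v -> 0 < tagged_width c -> chain u v s ->
  Phi c <= riemann_sum (fun t => q (h t) `^ p) s +
           p * y c `^ (p - 1) * \sum_(d <- s) defect d.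
Proof.
move=> cu cv w0 cs; set K := p * _; set g := fun t => _.
have K0 : 0 <= K by rewrite mulr_ge0 ?powR_ge0.
have wE : \sum_(d <- s) tagged_width d = tagged_width c.
  by rewrite (sum_width cs) /tagged_width cu cv.
have VE : V c <= \sum_(d <- s) (q (h (tag_point d)) * tagged_width d + defect d).
  rewrite /V cu cv -(sum_telescope H cs).
  apply: le_trans (_ : \sum_(d <- s) V d <= _); last first.
    exact: (ler_sum_all (chain_width_gt0 cs) V_le).
  elim: (s) => [|d t IH]; first by rewrite !big_nil seminorm0.
  by rewrite !big_cons (le_trans (seminormD _ _))// lerD2l.
have : \sum_(d <- s) (y c `^ p * tagged_width d + K * (q (h (tag_point d)) * tagged_width d)
          - K * y c * tagged_width d) <= riemann_sum g s.
  apply: (ler_sum_all (chain_width_gt0 cs)) => d wd.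
  have := powR_tangent hp (y_ge0 w0) (seminorm_ge0 (h (tag_point d))).
  rewrite -(ler_pM2r wd) -/K => /(le_trans _); apply.
  by rewrite le_eqVlt; apply/orP; left; apply/eqP; ring.
have yV : y c * tagged_width c = V c by rewrite /y mulfVK// gt_eqF.
rewrite sumrB big_split/= -!mulr_sumr wE -mulrA yV -/(Phi c) => hs.
have := ler_wpM2l K0 VE; rewrite big_split/= mulrDr; lra.
Qed.

(** The fine chain is cut at the end points of [D], which alters no Riemann sum, and [cell_le]
    applies to each piece; [K] dominates the tangent slopes of all cells of [D]. *)
Let refine_le (d : I -> R) (K : R) D u s :
  (forall c, c \in D -> p * y c `^ (p - 1) <= K) ->
  (forall c, c \in D -> forall t, t != right_end c ->
     d t <= `|sval (right_end c) - sval t|) ->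
  chain u hi D -> chain u hi s -> delta_fine d s ->
  exists s', [/\ chain u hi s', delta_fine d s',
    forall g, riemann_sum g s' = riemann_sum g s &
    \sum_(c <- D) Phi c <= riemann_sum (fun t => q (h t) `^ p) s' +
       K * \sum_(c <- s') defect c].
Proof.
elim: D u s => [u s _ _ -> cs fs|c D IH u s DK Dd [cu uc _ cD] cs fs].
  case: s cs fs => [|c s /= [cu uc _ /chain_le]]; last by rewrite leNgt uc.
  by exists [::]; split => //; rewrite /riemann_sum !big_nil mulr0 addr0.
have cin : c \in c :: D by rewrite mem_head.
have Din x : x \in D -> x \in c :: D by rewrite in_cons => ->; rewrite orbT.
have [s1 [s2 [c1 c2 f1 f2 E]]] :=
  split_chain (Dd _ cin) (ltW uc) (upper_end_ge hab _) cs fs.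
have [s' [cs' fs' E' hs']] := IH _ s2 (fun x xD => DK _ (Din _ xD))
  (fun x xD => Dd _ (Din _ xD)) cD c2 f2.
exists (s1 ++ s'); split; first exact: chain_cat cs'.
- exact: delta_fine_cat.
- by move=> g; rewrite riemann_sum_cat E' E.
- rewrite big_cons riemann_sum_cat big_cat/= mulrDr addrACA lerD//.
  have w0 : 0 < tagged_width c by rewrite /tagged_width cu subr_gt0.
  apply: le_trans (cell_le cu erefl w0 c1) _.
  by rewrite lerD2l ler_wpM2r ?DK// sumr_ge0.
Qed.

(** A cell fine for such a gauge contains no point of [D] other than its tag, which prepares the
    cuts. *)
Let separated (D : seq I) : exists2 d : I -> R, is_gauge d &
  forall w, w \in D -> forall t, t != w -> d t <= `|sval w - sval t|.
Proof.
elim: D => [|w D [d d0 IH]]; first by exists (fun=> 1) => // t; exact: ltr01.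
exists (fun t => Num.min (d t) (if t == w then 1 else `|sval w - sval t|)).
  apply: gauge_min => // t; case: eqVneq => [//|tw].
  rewrite normr_gt0 subr_eq0; apply: contra tw => /eqP wt.
  by apply/eqP/interval_type_inj.
move=> v; rewrite in_cons => /predU1P[->|vD] t tv; rewrite ge_min.
  by rewrite (negbTE tv) lexx orbT.
by rewrite IH.
Qed.

Let lower_sum : henstock_primitive q h H -> forall D, chain lo hi D ->
  forall e, 0 < e -> \forall s \near fine_chains,
    \sum_(c <- D) Phi c <= riemann_sum (fun t => q (h t) `^ p) s + e.
Proof.
move=> hH D cD e e0.
pose K := \sum_(c <- D) p * y c `^ (p - 1).
have term0 c : 0 <= p * y c `^ (p - 1) by rewrite mulr_ge0 ?powR_ge0.
have K0 : 0 <= K by rewrite sumr_ge0.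
have DK c : c \in D -> p * y c `^ (p - 1) <= K.
  by move=> cin; rewrite /K (big_rem c)//= lerDl sumr_ge0.
(* The [+ 1] allows for [K = 0]. *)
have eK : 0 < e / (K + 1) by rewrite divr_gt0// ltr_wpDl.
have [d1 d10 h1] := hH _ eK.
have [d2 d20 h2] := separated (map right_end D).
exists (fun t => Num.min (d1 t) (d2 t)); first exact: gauge_min.
move=> s cs fs /=.
have [|s' [cs' fs' E hs']] := refine_le DK _ cD cs fs.
  move=> c cin t tc; rewrite ge_min (h2 (right_end c)) ?orbT//.
  by apply/mapP; exists c.
apply: le_trans hs' _; rewrite E lerD2l.
apply: le_trans (_ : K * (e / (K + 1)) <= _).
  by rewrite ler_wpM2l// ltW//; apply: h1 cs' (delta_fine_minl fs').
by rewrite mulrA ler_pdivrMr ?ltr_wpDl// mulrDr mulr1 mulrC lerDl ltW.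
Qed.

(* The integral of [q (h t) `^ p] is the supremum over partitions of
   [\sum q (H v - H u) `^ p / (v - u) `^ (p - 1)] (the Riesz variation of the
   primitive): comparing an interval with a tagged point through the tangent of
   [x `^ p] bounds the Riemann sums from both sides. *)
Lemma KH_powR_of_primitive (M : R) : henstock_primitive q h H ->
  mean_le (fun t => q (h t) `^ p) M ->
  exists z, KH_has_integral (fun t => q (h t) `^ p) z.
Proof.
move=> hH hM; pose S := [set \sum_(c <- D) Phi c | D in chain lo hi].
have SM : ubound S (M + 1).
  move=> _ [D cD <-].
  have := filter_ex (filterI hM (lower_sum hH cD ltr01)) => -[s [/= sM sD]].
  by rewrite (le_trans sD)// lerD2r.
have [D0 cD0] := filter_ex (near_chain hab).
have S0 : has_sup S by split; [exists (\sum_(c <- D0) Phi c), D0 | exists (M + 1)].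
exists (sup S) => e e0; have e20 : 0 < e / 2 by rewrite divr_gt0.
have e40 : 0 < e / 4 by rewrite divr_gt0.
have [_ [D cD <-] hD] := sup_adherent e40 S0.
near=> s.
have up : riemann_sum (fun t => q (h t) `^ p) s <= \sum_(c <- s) Phi c + e / 2.
  by near: s; exact: upper_sum.
have low : \sum_(c <- D) Phi c <= riemann_sum (fun t => q (h t) `^ p) s + e / 4.
  by near: s; exact: lower_sum.
have sS : \sum_(c <- s) Phi c <= sup S.
  apply: sup_upper_bound => //; exists s => //.
  by near: s; exact: near_chain.
by rewrite real_ltr_norml ?num_real//; apply/andP; split; lra.
Unshelve. all: by end_near.
Qed.

End power_integrable.

(** * Topologies generated by a sequence of semi-norms *)

Section generated_topology.
Context {R : realType} {V : preTopologicalLmodType R} (Q : nat -> V -> R).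
Hypothesis hQ : forall i, seminorm (Q i).
Hypothesis hgen : generates_topology Q.

Lemma open_seminorm_lt (i : nat) (x : V) (e : R) : open [set y | Q i (y - x) < e].
Proof.
apply/hgen => y /= ye; exists [set i], (e - Q i (y - x)); split.
- exact: finite_set1.
- by rewrite subr_gt0.
- move=> z /(_ i erefl) zy /=.
  by apply: le_lt_trans (seminorm_triangle (hQ i) y _ _) _; rewrite -ltrBrDr.
Qed.

Lemma near_seminorm_lt (i : nat) (x : V) (e : R) : 0 < e ->
  \forall y \near x, Q i (y - x) < e.
Proof.
move=> e0; apply: open_nbhs_nbhs; split; first exact: open_seminorm_lt.
by rewrite /= subrr (seminorm0 (hQ i)).
Qed.

Lemma near_seminorms_lt (n : nat) (x : V) (e : R) : 0 < e ->
  nbhs x [set y | forall i : 'I_n, Q i (y - x) < e].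
Proof. by move=> e0; apply: filter_forall => i; exact: near_seminorm_lt. Qed.

Lemma generated_continuous_seminorm (i : nat) : continuous_seminorm (Q i).
Proof.
split=> // x; apply/cvgrPdist_lt => e e0; near=> y.
apply: le_lt_trans (_ : Q i (y - x) < e); last by near: y; exact: near_seminorm_lt.
rewrite ler_norml; apply/andP; split.
  rewrite lerBrDr addrC lerBlDr addrC -{1}(subrK x y) addrC.
  by rewrite [Q i x + _]addrC (seminormD (hQ i)).
by rewrite lerBlDr -{1}(subrKC y x) (seminorm_distC (hQ i)) addrC (seminormD (hQ i)).
Unshelve. all: by end_near. Qed.

Lemma finite_set_nat_bounded (F : set nat) : finite_set F ->
  exists n, forall i, F i -> (i < n)%N.
Proof.
move=> /finite_fsetP[S ->]; exists (\max_(i <- finmap.enum_fset S) i).+1 => i /= iS.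
by rewrite ltnS; exact: (@leq_bigmax_seq _ _ xpredT id).
Qed.

Lemma near_seminorm_ball (A : set V) (x : V) : nbhs x A ->
  exists n e, 0 < e /\ forall y, (forall i, (i < n)%N -> Q i (y - x) < e) -> A y.
Proof.
rewrite nbhsE => -[B [/hgen oB Bx] BA].
have [F [e [/finite_set_nat_bounded[n Fn] e0 FB]]] := oB x Bx.
exists n, e; split => // y yn; apply/BA/FB => i /Fn; exact: yn.
Qed.

(** Continuity at [0] gives a ball of finitely many [Q i] on which [q < 1]; homogeneity scales any
    [x] into it. *)
Lemma dominated_seminorm (q : V -> R) : continuous_seminorm q ->
  exists n C, 0 <= C /\ forall x, q x <= C * \sum_(i < n) Q i x.
Proof.
move=> [sq cq].
have : nbhs (0 : V) (q @^-1` [set r | r < 1]).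
  apply: cq; apply: open_nbhs_nbhs; split; first exact: open_lt.
  by rewrite /= seminorm0.
move=> /near_seminorm_ball[n [e [e0 h]]].
exists n, (2 / e); split; first by rewrite divr_ge0// ltW.
move=> x; set S := \sum_(i < n) _.
have S0 : 0 <= S by apply: sumr_ge0 => i _; exact: seminorm_ge0.
apply/ler_addgt0Pr => d d0.
(* [eta] avoids dividing by a vanishing [S]; its size makes [1 / k] equal to [2 / e * S + d]. *)
pose eta := d * e / 2.
have eta0 : 0 < eta by rewrite divr_gt0// mulr_gt0.
pose k := e / 2 / (S + eta).
have k0 : 0 < k by rewrite !divr_gt0// ltr_wpDl.
have : q (k *: x) < 1.
  apply: (h (k *: x)) => i ilt; rewrite subr0 (seminormZ (hQ i)) gtr0_norm//.
  have : Q i x <= S.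
    rewrite /S (bigD1 (Ordinal ilt))//= lerDl sumr_ge0// => j _.
    exact: seminorm_ge0.
  move=> QS; rewrite /k mulrAC ltr_pdivrMr ?ltr_wpDl//.
  have eS : e / 2 * Q i x <= e / 2 * S by rewrite ler_pM2l ?divr_gt0.
  have : 0 < e * eta by rewrite mulr_gt0.
  have : 0 <= e * S by rewrite mulr_ge0// ltW.
  rewrite mulrDr; lra.
rewrite seminormZ// gtr0_norm// mulrC -ltr_pdivlMr// => /ltW/le_trans; apply.
rewrite /k /eta le_eqVlt; apply/orP; left; apply/eqP.
have : S + d * e / 2 != 0 by rewrite gt_eqF// ltr_wpDl.
by move=> Sn0; field; rewrite gt_eqF//=; lra.
Qed.

Lemma cvg_seminormP (u : nat -> V) (l : V) :
  u n @[n --> \oo] --> l <->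
  forall i e, 0 < e -> \forall n \near \oo, Q i (u n - l) < e.
Proof.
split=> [ul i e e0|h].
  exact: (ul _ (near_seminorm_lt i l e0)).
move=> A /near_seminorm_ball[n [e [e0 hA]]].
have : \forall m \near \oo, forall i : 'I_n, Q i (u m - l) < e.
  by apply: filter_forall => i; exact: h.
by apply: filterS => m hm; apply: hA => i ilt; exact: (hm (Ordinal ilt)).
Qed.

Lemma seminorm_cauchy_dominated (u : nat -> V) :
  (forall i, seminorm_cauchy (Q i) u) ->
  forall q, continuous_seminorm q -> seminorm_cauchy q u.
Proof.
move=> hu q /dominated_seminorm[n [C [C0 hC]]] e e0.
pose d := e / ((C + 1) * n.+1%:R).
have C10 : 0 < C + 1 by rewrite ltr_wpDl.
have d0 : 0 < d by rewrite divr_gt0// mulr_gt0.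
have /choice[N hN] := fun i => hu i d d0.
exists (\max_(i < n) N i)%N => m k mN kN.
apply: le_lt_trans (hC _) _.
apply: le_lt_trans (_ : C * (n%:R * d) < _).
  have -> : n%:R * d = \sum_(i < n) d by rewrite sumr_const card_ord mulr_natl.
  rewrite ler_wpM2l//; apply: ler_sum => i _; apply/ltW/hN.
    exact: leq_trans (leq_bigmax _) mN.
  exact: leq_trans (leq_bigmax _) kN.
have -> : e = (C + 1) * (n.+1%:R * d).
  by rewrite mulrA /d mulrCA mulfV ?mulr1// gt_eqF// mulr_gt0.
have : n%:R * d < n.+1%:R * d by rewrite ltr_pM2r// ltr_nat.
have : 0 <= n%:R * d by rewrite mulr_ge0// ltW.
nra.
Qed.

End generated_topology.

(** * Calculus of upper means *)

Section means.
Context {R : realType} {a b : R} (hab : a < b).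
Local Notation I := (interval_type a b).
Local Notation cell := (tagged_interval a b).
Local Notation mean_le := (mean_le hab).
Implicit Types (g h : I -> R) (M N : R).

Lemma le_riemann_sum (u v : I) (s : seq cell) g h : chain u v s ->
  (forall t, g t <= h t) -> riemann_sum g s <= riemann_sum h s.
Proof.
move=> cs gh; apply: (ler_sum_all (chain_width_ge0 cs)) => c w0.
by rewrite ler_wpM2r.
Qed.

Lemma mean_leW g h M N : (forall t, g t <= h t) -> M <= N ->
  mean_le h M -> mean_le g N.
Proof.
move=> gh MN; apply: filterS2 (near_chain hab) => s cs /= hM.
exact: le_trans (le_riemann_sum cs gh) (le_trans hM MN).
Qed.

Lemma mean_leD g h M N : mean_le g M -> mean_le h N ->
  mean_le (fun t => g t + h t) (M + N).
Proof.
apply: filterS2 => s /= gM hN; rewrite /riemann_sum.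
by under eq_bigr do rewrite mulrDl; rewrite big_split lerD.
Qed.

Lemma mean_leZ k g M : 0 <= k -> mean_le g M ->
  mean_le (fun t => k * g t) (k * M).
Proof.
move=> k0; apply: filterS => s /= gM; rewrite /riemann_sum.
by under eq_bigr do rewrite -mulrA; rewrite -mulr_sumr ler_wpM2l.
Qed.

Lemma mean_le_cst k : mean_le (fun=> k) (k * (b - a)).
Proof.
apply: filterS (near_chain hab) => s cs.
by rewrite /= /riemann_sum -mulr_sumr (sum_width cs).
Qed.

Lemma mean_le_sum n (g : nat -> I -> R) (M : nat -> R) :
  (forall i, (i < n)%N -> mean_le (g i) (M i)) ->
  mean_le (fun t => \sum_(i < n) g i t) (\sum_(i < n) M i).
Proof.
elim: n => [_|n IH hn].
  apply: mean_leW (mean_le_cst 0) => [t|]; first by rewrite big_ord0.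
  by rewrite mul0r big_ord0.
have h1 := IH (fun i ilt => hn i (ltnW ilt)).
apply: mean_leW (mean_leD h1 (hn n (ltnSn n))) => [t|].
  by rewrite big_ord_recr.
by rewrite big_ord_recr.
Qed.

(** Countable subadditivity of the upper mean. The number of terms needed to dominate [x t] may grow
    without bound as [t] varies; the gluing of gauges absorbs this. *)
Lemma mean_le_countable (w : nat -> I -> R) (e : nat -> R) (x : I -> R) M :
  (forall k t, 0 <= w k t) -> (forall k, mean_le (w k) (e k)) ->
  (forall n, \sum_(k < n) e k <= M) ->
  (forall t, exists J, x t <= \sum_(k < J) w k t) -> mean_le x M.
Proof.
move=> w0 we eM /choice[J hJ].
have := @countable_glue _ _ _ hab (fun k c => w k (tag_point c) * tagged_width c)
  e J M (fun k c => @mulr_ge0 _ _ _ (w0 k _)) we eM.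
apply: filterS2 (near_chain hab) => s cs /=; apply: le_trans.
apply: (ler_sum_all (chain_width_ge0 cs)) => c c0.
by rewrite -mulr_suml ler_wpM2r.
Qed.

(** From [z <= 1 + z ^ p] with [z = x t / eta]: smallness in the mean of order [p] gives smallness
    in the mean of order one. *)
Lemma mean_le_root (p : R) (x : I -> R) (eta : R) : 1 <= p -> 0 < eta ->
  (forall t, 0 <= x t) -> mean_le (fun t => x t `^ p) (eta `^ p) ->
  mean_le x (eta * (b - a + 1)).
Proof.
move=> p1 eta0 x0 hx; have ep : 0 < eta `^ p by rewrite powR_gt0.
have c0 : 0 <= eta / eta `^ p by rewrite ltW// divr_gt0.
apply: mean_leW (mean_leD (mean_le_cst eta) (mean_leZ c0 hx)); last first.
  by rewrite mulfVK ?gt_eqF// [leRHS]mulrDr mulr1.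
move=> t; rewrite mulrAC -mulrA -{1}(mulr1 eta) -mulrDr.
have z0 : 0 <= x t / eta by rewrite divr_ge0// ltW.
rewrite -[X in X <= _](@mulfVK _ eta) ?gt_eqF// mulrC ler_pM2l//.
have -> : x t `^ p / eta `^ p = (x t / eta) `^ p.
  have xE : x t = x t / eta * eta by rewrite mulfVK ?gt_eqF.
  by rewrite [in LHS]xE powRM ?(ltW eta0)// mulfK ?gt_eqF.
have [z1|z1] := leP (x t / eta) 1; first by rewrite ler_wpDr ?powR_ge0.
by rewrite ler_wpDl// le1r_powR// ltW.
Qed.

End means.

(** * Minkowski's inequality for the semi-norms of U^p *)

Section U_seminorms.
Context {R : realType} {a b : R} (hab : a < b) {X : preTopologicalLmodType R}.
Local Notation I := (interval_type a b).
Local Notation mean_le := (mean_le hab).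
Context (p : R) (hp : 1 <= p) (q : X -> R) (hq : seminorm q).
Implicit Types f g : I -> X.

Let p0 : 0 < p. Proof. exact: lt_le_trans hp. Qed.

Lemma upper_mean_lty f : (upper_mean p q f < +oo)%E <->
  exists M, mean_le (fun t => q (f t) `^ p) M.
Proof.
rewrite upper_mean_ltyP; split=> [[d d0 [M h]]|[M [d d0 h]]].
  by exists M, d => // s cs fs; apply: h; split => //; exact: chain_partition cs.
exists d => //; exists M => D [/(partition_chain hab)[s Ds cs] fD].
by rewrite (perm_big s)//; apply: h => //; rewrite /delta_fine -(perm_all _ Ds).
Qed.

Lemma upper_mean_ge0 f : (0 <= upper_mean p q f)%E.
Proof.
apply: le_ereal_inf_tmp => _ [d d0 <-].
have [s cs fs] := cousin d0 (lower_end_le hab (upper_end hab)).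
apply: le_trans (_ : (riemann_sum (fun t => q (f t) `^ p) s)%:E <= _)%E; last first.
  by apply: ereal_sup_ubound; exists s => //; split => //; exact: chain_partition cs.
rewrite lee_fin /riemann_sum big_seq sumr_ge0// => c cin.
by rewrite mulr_ge0 ?powR_ge0// (allP (chain_width_ge0 cs)).
Qed.

Lemma U_seminorm_ge0 f : 0 <= U_seminorm p q f.
Proof. exact: powR_ge0. Qed.

Lemma powRVK (A : R) : 0 <= A -> (A `^ p) `^ p^-1 = A.
Proof. by move=> A0; rewrite -powRrM mulfV ?gt_eqF// powRr1. Qed.

Lemma U_seminorm_le f A : 0 <= A ->
  mean_le (fun t => q (f t) `^ p) (A `^ p) -> U_seminorm p q f <= A.
Proof.
move=> A0 [d d0 h]; rewrite /U_seminorm.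
have um : (upper_mean p q f <= (A `^ p)%:E)%E.
  apply: le_trans (_ : ereal_sup [set (\sum_(c <- D)
      q (f (tag_point c)) `^ p * tagged_width c)%:E
        | D in fine_partitions d] <= _)%E.
    by apply: ereal_inf_lbound; exists d.
  apply: ge_ereal_sup => _ [D [/(partition_chain hab)[s Ds cs] fD] <-].
  rewrite lee_fin (perm_big s)//; apply: h => //.
  by rewrite /delta_fine -(perm_all _ Ds).
have um0 := upper_mean_ge0 f.
have fin : upper_mean p q f \is a fin_num.
  by rewrite ge0_fin_numE// (le_lt_trans um)// ltry.
rewrite -[leRHS](powRVK A0) ge0_ler_powR ?invr_ge0 ?(ltW p0)//.
- by rewrite nnegrE fine_ge0.
- by rewrite nnegrE powR_ge0.
- by rewrite -lee_fin fineK.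
Qed.

(** Strictness lets a single gauge realise the bound. Finiteness of the upper mean matters because
    [fine] sends [+oo] to [0]. *)
Lemma U_seminorm_lt f A : (upper_mean p q f < +oo)%E ->
  U_seminorm p q f < A -> mean_le (fun t => q (f t) `^ p) (A `^ p).
Proof.
move=> fU fA; have um0 := upper_mean_ge0 f.
have A0 : 0 <= A by rewrite ltW// (le_lt_trans _ fA)// U_seminorm_ge0.
have fin : upper_mean p q f \is a fin_num by rewrite ge0_fin_numE.
have : (upper_mean p q f < (A `^ p)%:E)%E.
  rewrite -(fineK fin) lte_fin.
  have -> : fine (upper_mean p q f) = U_seminorm p q f `^ p.
    by rewrite /U_seminorm -powRrM mulVf ?gt_eqF// powRr1// fine_ge0.
  by apply: gt0_ltr_powR => //; rewrite nnegrE ?U_seminorm_ge0.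
move=> /ereal_inf_lt[_ [d d0 <-]] hs; exists d => // s cs fs.
rewrite /= -lee_fin; apply: le_trans (ltW hs).
by apply: ereal_sup_ubound; exists s => //; split => //; exact: chain_partition cs.
Qed.

(** Convexity at [m = (x + y) / (A + B)], the combination of [x / A] and [y / B] with weights
    [A / (A + B)] and [B / (A + B)]. If [x ^ p] and [y ^ p] have means at most [A ^ p] and [B ^ p],
    the right-hand side has mean at most [(A + B) ^ p], which is Minkowski's inequality. *)
Lemma powRD_weighted (A B x y : R) : 0 < A -> 0 < B -> 0 <= x -> 0 <= y ->
  (x + y) `^ p <= (A + B) `^ p * (A / (A + B)) / A `^ p * x `^ p +
                  (A + B) `^ p * (B / (A + B)) / B `^ p * y `^ p.
Proof.
move=> A0 B0 x0 y0; have AB : 0 < A + B by rewrite addr_gt0.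
pose m := (x + y) / (A + B).
have m0 : 0 <= m by rewrite divr_ge0 ?addr_ge0// ltW.
have xyE : x + y = (A + B) * m by rewrite mulrC mulfVK// gt_eqF.
have xE : x `^ p = A `^ p * (x / A) `^ p.
  by rewrite -powRM ?divr_ge0 ?(ltW A0)// mulrC mulfVK// gt_eqF.
have yE : y `^ p = B `^ p * (y / B) `^ p.
  by rewrite -powRM ?divr_ge0 ?(ltW B0)// mulrC mulfVK// gt_eqF.
rewrite xyE powRM ?(ltW AB)// xE yE -!mulrA !(mulKf (lt0r_neq0 (powR_gt0 p _)))//.
rewrite -mulrDr ler_pM2l ?powR_gt0//.
have h1 := powR_tangent hp m0 (divr_ge0 x0 (ltW A0)).
have h2 := powR_tangent hp m0 (divr_ge0 y0 (ltW B0)).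
have {}h1 := ler_wpM2l (ltW (divr_gt0 A0 AB)) h1.
have {}h2 := ler_wpM2l (ltW (divr_gt0 B0 AB)) h2.
apply: le_trans (_ : _ <= A / (A + B) * (x / A) `^ p + B / (A + B) * (y / B) `^ p) _; last first.
  by rewrite !mulrA.
apply: le_trans (lerD h1 h2); rewrite le_eqVlt; apply/orP; left; apply/eqP.
have mE : A / (A + B) * (x / A - m) + B / (A + B) * (y / B - m) = 0.
  by rewrite /m; field; rewrite !gt_eqF.
set t := m `^ p; set k := p * _.
transitivity ((A / (A + B) + B / (A + B)) * t +
  k * (A / (A + B) * (x / A - m) + B / (A + B) * (y / B - m))); last by ring.
by rewrite mE mulr0 addr0 -mulrDl mulfV ?mul1r// gt_eqF.
Qed.

Lemma U_seminormD f g : (upper_mean p q f < +oo)%E -> (upper_mean p q g < +oo)%E ->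
  U_seminorm p q (f + g) <= U_seminorm p q f + U_seminorm p q g.
Proof.
move=> fU gU; apply/ler_addgt0Pr => e e0; have e20 : 0 < e / 2 by rewrite divr_gt0.
have hf A := @U_seminorm_lt f A fU; have hg A := @U_seminorm_lt g A gU.
move: (U_seminorm_ge0 f) (U_seminorm_ge0 g) hf hg.
move: (U_seminorm p q f) (U_seminorm p q g) => A' B' A'0 B'0 hf hg.
(* The added [e / 2] makes the divisors [A] and [B] positive and supplies the strict inequalities
   that yield gauges. *)
pose A := A' + e / 2; pose B := B' + e / 2.
have A0 : 0 < A by rewrite ltr_wpDl.
have B0 : 0 < B by rewrite ltr_wpDl.
have -> : A' + B' + e = A + B by rewrite /A /B addrACA -splitr.
have AB : 0 < A + B by rewrite addr_gt0.
apply: U_seminorm_le; first exact: ltW.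
have fA : mean_le (fun t => q (f t) `^ p) (A `^ p) by apply: hf; rewrite ltrDl.
have gB : mean_le (fun t => q (g t) `^ p) (B `^ p) by apply: hg; rewrite ltrDl.
have c0 C : 0 < C -> 0 <= (A + B) `^ p * (C / (A + B)) / C `^ p.
  by move=> C0; rewrite !(divr_ge0, mulr_ge0, powR_ge0)// ltW.
apply: mean_leW (mean_leD (mean_leZ (c0 _ A0) fA) (mean_leZ (c0 _ B0) gB)) => [t|].
  apply: le_trans (powRD_weighted A0 B0 (seminorm_ge0 hq _) (seminorm_ge0 hq _)).
  rewrite ge0_ler_powR ?nnegrE ?(ltW p0) ?addr_ge0 ?(seminorm_ge0 hq)//.
  exact: seminormD.
rewrite !mulfVK ?gt_eqF ?powR_gt0// -mulrDr -mulrDl mulfV ?mulr1//.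
by rewrite gt_eqF.
Qed.

Lemma U_seminormZ_le k f : (upper_mean p q f < +oo)%E ->
  U_seminorm p q (k *: f) <= `|k| * U_seminorm p q f.
Proof.
move=> fU; apply/ler_addgt0Pr => e e0.
pose A := U_seminorm p q f + e / (`|k| + 1).
have k1 : 0 < `|k| + 1 by rewrite ltr_wpDl.
have A0 : 0 <= A by rewrite addr_ge0 ?U_seminorm_ge0// divr_ge0// ltW.
apply: le_trans (_ : `|k| * A <= _); last first.
  rewrite mulrDr lerD2l mulrA ler_pdivrMr// mulrDr mulr1 mulrC lerDl.
  exact: ltW.
apply: U_seminorm_le; first by rewrite mulr_ge0.
rewrite powRM//; have kp : 0 <= `|k| `^ p by rewrite powR_ge0.
apply: mean_leW (mean_leZ kp (U_seminorm_lt fU (_ : _ < A))) => [t||].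
- by rewrite -powRM ?(seminorm_ge0 hq)// -(seminormZ hq).
- by [].
- by rewrite ltrDl divr_gt0.
Qed.

End U_seminorms.

(** * Linearity and variation of primitives *)

Section primitives.
Context {R : realType} {a b : R} (hab : a < b) {X : lmodType R}.
Local Notation I := (interval_type a b).
Local Notation cell := (tagged_interval a b).
Local Notation mean_le := (mean_le hab).
Local Notation primitive := (henstock_primitive hab).
Local Notation fine_chains := (fine_chains hab).
Local Notation lo := (lower_end hab).
Local Notation hi := (upper_end hab).
Context (q : X -> R) (hq : seminorm q).

Lemma seminorm_sum (T : Type) (s : seq T) (G : T -> X) :
  q (\sum_(c <- s) G c) <= \sum_(c <- s) q (G c).
Proof.
elim: s => [|c s IH]; first by rewrite !big_nil (seminorm0 hq).
by rewrite !big_cons (le_trans (seminormD hq _ _))// lerD2l.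
Qed.

Lemma henstock_primitiveD k (f g F G : I -> X) :
  primitive q f F -> primitive q g G ->
  primitive q (k *: f + g) (k *: F + G).
Proof.
move=> hF hG e e0.
have k1 : 0 < `|k| + 1 by rewrite ltr_wpDl.
have d0 : 0 < e / (2 * (`|k| + 1)) by rewrite divr_gt0// mulr_gt0.
have e20 : 0 < e / 2 by rewrite divr_gt0.
apply: filterS2 (hF _ d0) (hG _ e20) => s /= sF sG.
apply: le_lt_trans (_ : `|k| * (e / (2 * (`|k| + 1))) + e / 2 < _); last first.
  have dE : (`|k| + 1) * (e / (2 * (`|k| + 1))) = e / 2.
    by rewrite invfM mulrCA [_ * (2^-1 * _)]mulrCA mulfV ?mulr1 ?gt_eqF.
  by rewrite [ltRHS]splitr ltrD2r -dE ltr_pM2r// ltrDl.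
apply: le_trans (_ : \sum_(c <- s) (`|k| * henstock_defect q f F c +
                     henstock_defect q g G c) <= _).
  apply: ler_sum => c _; rewrite /henstock_defect -(seminormZ hq).
  apply: le_trans (seminormD hq _ _); rewrite le_eqVlt; apply/orP; left.
  apply/eqP; congr q; rewrite /= !fctE.
  rewrite !scalerBr !scalerDr !scalerA [k * _]mulrC !opprD.
  by rewrite [X in X + _ = _]addrACA [LHS]addrACA.
by rewrite big_split/= -mulr_sumr lerD ?ler_wpM2l// ltW.
Qed.

Lemma defect_subsum (f F : I -> X) (u v : I) (s : seq cell) : chain u v s ->
  q (F v - F u - \sum_(c <- s) tagged_width c *: f (tag_point c)) <=
  \sum_(c <- s) henstock_defect q f F c.
Proof.
move=> cs; rewrite -(sum_telescope F cs) -sumrB; exact: seminorm_sum.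
Qed.

(** On a fine refinement the increments are bounded by the Riemann sum plus the defects;
    subadditivity brings the bound back to the arbitrary chain [s]. *)
Lemma primitive_variation_le (h H : I -> X) M s :
  primitive q h H -> mean_le (fun t => q (h t)) M -> chain lo hi s ->
  \sum_(c <- s) q (H (right_end c) - H (left_end c)) <= M.
Proof.
move=> hH hM cs; apply/ler_addgt0Pr => e e0.
have [d d0 hd] := filterI (hH _ e0) hM.
have [||s' [cs' fs' ss']] := refine_subadd (phi := fun x y => q (H y - H x)) _ _ d0 cs.
- by move=> x; rewrite subrr (seminorm0 hq).
- by move=> x y z; rewrite [leRHS]addrC; exact: seminorm_triangle.
apply: le_trans ss' _; have [/= h1 h2] := hd _ cs' fs'.
apply: le_trans (lerD h2 (ltW h1)); rewrite /riemann_sum -big_split/=.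
apply: (ler_sum_all (chain_width_gt0 cs')) => c w0.
rewrite mulrC -{1}(gtr0_norm w0) -(seminormZ hq).
rewrite -{1}(subrKC (tagged_width c *: h (tag_point c)) (H _ - H _)).
exact: seminormD.
Qed.

Lemma primitive_increment_le (h H : I -> X) M v :
  primitive q h H -> mean_le (fun t => q (h t)) M -> q (H v - H lo) <= M.
Proof.
move=> hH hM; have g1 : is_gauge (fun _ : I => 1 : R) by move=> t; exact: ltr01.
have [s cs _] := cousin g1 (lower_end_le hab v).
have [t ct _] := cousin g1 (upper_end_ge hab v).
apply: le_trans (primitive_variation_le hH hM (chain_cat cs ct)).
rewrite big_cat/= -(sum_telescope H cs) -[leLHS]addr0 lerD ?seminorm_sum//.
by apply: sumr_ge0 => c _; exact: seminorm_ge0.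
Qed.

End primitives.

(** * Description of L^p and primitives common to all semi-norms *)

Section power_functions.
Context {R : realType} {a b : R} (hab : a < b) {X : preTopologicalLmodType R}.
Local Notation I := (interval_type a b).
Local Notation cell := (tagged_interval a b).
Local Notation mean_le := (mean_le hab).
Local Notation primitive := (henstock_primitive hab).
Local Notation fine_chains := (fine_chains hab).
Local Notation lo := (lower_end hab).
Local Notation hi := (upper_end hab).
Context (rho : nat -> X -> R) (p : R) (hp : 1 <= p).

Let p0 : 0 < p. Proof. exact: lt_le_trans hp. Qed.

Lemma SKH_integrableP (q : X -> R) (f : I -> X) :
  SKH_integrable q f <-> exists F, primitive q f F.
Proof.
have hF F e : (exists2 delta : I -> R, is_gauge delta &
      forall D, fine_partitions delta D ->
        \sum_(c <- D) henstock_defect q f F c < e) <->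
    \forall s \near fine_chains, \sum_(c <- s) henstock_defect q f F c < e.
  by apply: fine_partitions_near => D s Ds; rewrite (perm_big _ Ds).
by split=> -[F FP]; exists F => e /FP /hF.
Qed.

Lemma KH_integrableP (g : I -> R) :
  KH_integrable g <-> exists z, KH_has_integral hab g z.
Proof.
have hz z e : (exists2 delta : I -> R, is_gauge delta &
      forall D, fine_partitions delta D -> `|riemann_sum g D - z| < e) <->
    \forall s \near fine_chains, `|riemann_sum g s - z| < e.
  by apply: fine_partitions_near => D s Ds; rewrite /riemann_sum (perm_big _ Ds).
by split=> -[z zP]; exists z => e /zP /hz.
Qed.

Lemma L_functions_sub : (L_functions p : set (I -> X)) `<=` U_functions p.
Proof.
move=> f fL q hq; have [_ /KH_integrableP[z /(_ 1 ltr01) hz]] := fL q hq.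
apply/(upper_mean_lty hab); exists (z + 1); apply: filterS hz => s /=.
by rewrite real_ltr_norml ?num_real// ltrBlDl => /andP[_ /ltW].
Qed.

(** The Kurzweil--Henstock condition on the power is not visibly stable under linear combinations;
    it is traded for membership in [U_functions], which is. *)
Lemma L_functionsP (f : I -> X) : L_functions p f <->
  U_functions p f /\ forall q, continuous_seminorm q -> exists F, primitive q f F.
Proof.
split=> [fL|[fU fP] q hq].
  split; first exact: L_functions_sub.
  by move=> q hq; apply/SKH_integrableP; have [] := fL q hq.
have [F FP] := fP q hq; split; first by apply/SKH_integrableP; exists F.
have [M hM] := (upper_mean_lty hab _ _ _).1 (fU q hq).
exact/KH_integrableP/(KH_powR_of_primitive hq.1 hp FP hM).
Qed.

Hypothesis hrho : forall i, continuous_seminorm (rho i).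
Hypothesis hgen : generates_topology rho.
Hypothesis hXc : sequentially_complete X.

Let srho i : seminorm (rho i). Proof. by case: (hrho i). Qed.

Lemma seminorm_limit (u : nat -> X) : (forall i, seminorm_cauchy (rho i) u) ->
  exists l, forall i e, 0 < e -> \forall n \near \oo, rho i (u n - l) < e.
Proof.
move=> /(seminorm_cauchy_dominated srho hgen) /hXc[l ul]; exists l.
exact/(cvg_seminormP srho hgen).
Qed.

(** Finitely many [rho i] dominate [q], and their defects can be added because [F] is the same for
    all of them. *)
Lemma primitive_dominated (f F : I -> X) : (forall i, primitive (rho i) f F) ->
  forall q, continuous_seminorm q -> primitive q f F.
Proof.
move=> hF q /(dominated_seminorm srho hgen)[n [C [C0 hC]]] e e0.
pose d := e / ((C + 1) * n.+1%:R).
have C10 : 0 < C + 1 by rewrite ltr_wpDl.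
have d0 : 0 < d by rewrite divr_gt0// mulr_gt0.
have : \forall s \near fine_chains, forall i : 'I_n,
   \sum_(c <- s) henstock_defect (rho i) f F c < d.
  by apply: filter_forall => i; exact: hF.
apply: filterS => s hs.
apply: le_lt_trans (_ : C * (n%:R * d) < _); last first.
  have -> : e = (C + 1) * (n.+1%:R * d).
    by rewrite mulrA /d mulrCA mulfV ?mulr1// gt_eqF// mulr_gt0.
  have : n%:R * d < n.+1%:R * d by rewrite ltr_pM2r// ltr_nat.
  have : 0 <= n%:R * d by rewrite mulr_ge0// ltW.
  nra.
have -> : n%:R * d = \sum_(i < n) d by rewrite sumr_const card_ord mulr_natl.
apply: le_trans (_ : C * \sum_(i < n) \sum_(c <- s) henstock_defect (rho i) f F c <= _).
  by rewrite exchange_big/= mulr_sumr; apply: ler_sum => c _; exact: hC.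
by rewrite ler_wpM2l//; apply: ler_sum => i _; exact/ltW/hs.
Qed.

(* The Riemann sums over fine chains from [lo] to [v] are Cauchy for every
   [rho i], whence a primitive not depending on [i]. *)
Lemma common_primitive (f : I -> X) :
  (forall i, exists F, primitive (rho i) f F) ->
  exists F, forall i, primitive (rho i) f F.
Proof.
move=> /choice[Fi hFi].
(* The gauge of index [n] serves the first [n + 1] semi-norms at once, each up to [1 / (n + 1)]. *)
have /choice[d hd] : forall n, exists d, is_gauge d /\ forall s,
    chain lo hi s -> delta_fine d s -> forall i : 'I_n.+1,
    \sum_(c <- s) henstock_defect (rho i) f (Fi i) c < n.+1%:R^-1.
  move=> n; have : \forall s \near fine_chains, forall i : 'I_n.+1,
      \sum_(c <- s) henstock_defect (rho i) f (Fi i) c < n.+1%:R^-1.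
    by apply: filter_forall => i; apply: hFi; rewrite invr_gt0.
  by move=> [d d0 h]; exists d.
(* [S n] is a Riemann sum over a chain from [lo] to [v] fine for [d n]: a single vector approximates
   the increments of all [Fi i] with [i <= n], although the [Fi i] are chosen independently. *)
have /choice[S hS] : forall v, exists S : nat -> X, forall n i, (i <= n)%N ->
    rho i (S n - (Fi i v - Fi i lo)) < n.+1%:R^-1.
  move=> v; suff /choice[S hS] : forall n, exists x, forall i, (i <= n)%N ->
    rho i (x - (Fi i v - Fi i lo)) < n.+1%:R^-1 by exists S.
  move=> n.
  have [dn0 hdn] := hd n.
  have [s cs fs] := cousin dn0 (lower_end_le hab v).
  have [t ct ft] := cousin dn0 (upper_end_ge hab v).
  exists (\sum_(c <- s) tagged_width c *: f (tag_point c)) => i; rewrite -ltnS => ilt.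
  have := hdn _ (chain_cat cs ct) (delta_fine_cat fs ft) (Ordinal ilt).
  apply: le_lt_trans; rewrite (seminorm_distC (srho i)) big_cat/= -[leLHS]addr0.
  apply: lerD; first exact: defect_subsum.
  by apply: sumr_ge0 => c _; exact: seminorm_ge0.
have small e : 0 < e -> \forall n \near \oo, n.+1%:R^-1 < e :> R.
  by move=> e0; have := near_infty_natSinv_lt (PosNum e0).
have /choice[F hF] : forall v, exists l, forall i e, 0 < e ->
    \forall n \near \oo, rho i (S v n - l) < e.
  move=> v; apply: seminorm_limit => i e e0.
  have e20 : 0 < e / 2 by rewrite divr_gt0.
  have [N _ hN] : \forall n \near \oo, rho i (S v n - (Fi i v - Fi i lo)) < e / 2.
    near=> n; apply: lt_trans (hS v n i _) _; first by near: n; exact: nbhs_infty_ge.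
    by near: n; exact: small.
  exists N => m n mN nN; rewrite (splitr e).
  apply: le_lt_trans (seminorm_triangle (srho i) (Fi i v - Fi i lo) _ _) _.
  by rewrite ltrD//; [exact: hN|rewrite (seminorm_distC (srho i)); exact: hN].
(* [F v] and the increment of [Fi i] differ by a vector that [rho i] does not see, so [F] inherits
   the defects of [Fi i]. *)
have FE v i : rho i (F v - (Fi i v - Fi i lo)) = 0.
  apply/eqP; rewrite eq_le (seminorm_ge0 (srho i)) andbT.
  apply/ler_addgt0Pr => e e0; have e20 : 0 < e / 2 by rewrite divr_gt0.
  near \oo => n; rewrite add0r (splitr e).
  apply: le_trans (seminorm_triangle (srho i) (S v n) _ _) _; apply: lerD.
    by rewrite (seminorm_distC (srho i)) ltW//; near: n; exact: hF.
  apply: le_trans (_ : n.+1%:R^-1 <= _).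
    by apply/ltW/hS; near: n; exact: nbhs_infty_ge.
  by rewrite ltW//; near: n; exact: small.
exists F => i e e0; apply: filterS (hFi i e e0) => s; apply: le_lt_trans.
apply: ler_sum => c _; rewrite /henstock_defect.
set r := right_end c; set l := left_end c; set w := _ *: _.
have -> : F r - F l - w = (F r - (Fi i r - Fi i lo)) -
    (F l - (Fi i l - Fi i lo)) + (Fi i r - Fi i l - w).
  have -> : Fi i r - Fi i l = (Fi i r - Fi i lo) - (Fi i l - Fi i lo).
    by rewrite opprB addrA subrK.
  move: (Fi i r - Fi i lo) (Fi i l - Fi i lo) => x y.
  by rewrite [X in _ = X + _](_ : _ = F r - F l - (x - y)) ?subrKA// !opprD addrACA.
apply: le_trans (seminormD (srho i) _ _) _; rewrite gerDr.
by apply: le_trans (seminormB (srho i) _ _) _; rewrite !FE addr0.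
Unshelve. all: by end_near. Qed.

End power_functions.

(** * Closedness of L^p in U^p *)

Lemma subrACA (V : zmodType) (x y z t : V) : x - y - (z - t) = x - z - (y - t).
Proof. by rewrite !opprD !opprK addrACA. Qed.

Section L_functions_closed.
Context {R : realType} {a b : R} (hab : a < b) {X : preTopologicalLmodType R}.
Local Notation I := (interval_type a b).
Local Notation cell := (tagged_interval a b).
Local Notation mean_le := (mean_le hab).
Local Notation primitive := (henstock_primitive hab).
Local Notation fine_chains := (fine_chains hab).
Local Notation lo := (lower_end hab).
Local Notation hi := (upper_end hab).
Context (rho : nat -> X -> R) (p : R) (hp : 1 <= p).
Hypothesis hrho : forall i, continuous_seminorm (rho i).
Hypothesis hgen : generates_topology rho.
Hypothesis hXc : sequentially_complete X.

Let srho i : seminorm (rho i). Proof. by case: (hrho i). Qed.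

Lemma sum_increment_limit (q : X -> R) (F : I -> X) (G : nat -> I -> X)
    (s : seq cell) :
  seminorm q ->
  (forall v e, 0 < e -> \forall m \near \oo, q (G m v - F v) < e) ->
  forall e, 0 < e -> \forall m \near \oo,
    \sum_(c <- s) q (F (right_end c) - F (left_end c) -
                     (G m (right_end c) - G m (left_end c))) < e.
Proof.
move=> hq hG; elim: s => [|c s IH] e e0.
  by near=> m; rewrite big_nil.
have e20 : 0 < e / 2 by rewrite divr_gt0.
have e40 : 0 < e / 2 / 2 by rewrite divr_gt0.
near=> m; rewrite big_cons (splitr e); apply: ltrD; last by near: m; exact: IH.
have -> : F (right_end c) - F (left_end c) -
    (G m (right_end c) - G m (left_end c)) =
    (G m (left_end c) - F (left_end c)) - (G m (right_end c) - F (right_end c)).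
  by rewrite subrACA -[G m (left_end c) - _]opprB -[G m (right_end c) - _]opprB opprK addrC.
apply: le_lt_trans (seminormB hq _ _) _; rewrite [ltRHS]splitr.
by apply: ltrD; near: m; exact: hG.
Unshelve. all: by end_near. Qed.

Lemma L_functions_closed (f : I -> X) : U_functions p f ->
  (forall n e, 0 < e -> exists2 g, L_functions p g &
     forall i, (i < n)%N -> U_seminorm p (rho i) (f - g) < e) ->
  L_functions p f.
Proof.
move=> fU hf; apply/(L_functionsP hab hp); split => //.
suff [F hF] : exists F, forall i, primitive (rho i) f F.
  by move=> q /(primitive_dominated hrho hgen hF); exists F.
(* The constant of [mean_le_root], by which closeness in [U_seminorm] becomes closeness in the mean
   of order one. *)
pose C := b - a + 1.
have C0 : 0 < C by rewrite ltr_wpDl// subr_ge0 ltW.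
have small e : 0 < e -> \forall n \near \oo, n.+1%:R^-1 < e :> R.
  by move=> e0; have := near_infty_natSinv_lt (PosNum e0).
have /choice[g hg] : forall n, exists g, L_functions p g /\
    forall i, (i < n)%N -> U_seminorm p (rho i) (f - g) < n.+1%:R^-1.
  by move=> n; have [|g gL gf] := hf n n.+1%:R^-1; [rewrite invr_gt0|exists g].
have /choice[F hF] : forall n, exists F, forall i, primitive (rho i) (g n) F.
  move=> n; apply: (common_primitive hrho hgen hXc) => i.
  have [_ gn] := (L_functionsP hab hp _).1 (hg n).1; exact: gn.
have fg n i : (i < n)%N -> mean_le (fun t => rho i (f t - g n t)) (n.+1%:R^-1 * C).
  move=> ilt; have gU := (L_functions_sub hab (hg n).1).
  apply: (@mean_le_root _ _ _ _ p) => //.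
    by move=> t; exact: seminorm_ge0.
  suff fgU : (upper_mean p (rho i) (f - g n)%R < +oo)%E.
    exact: (U_seminorm_lt hab hp fgU ((hg n).2 i ilt)).
  have [_ Ulin] := @U_functions_submod_closed R a b X p hp.
  have /set_mem/(_ _ (hrho i)) := Ulin (-1) (g n) f (mem_set gU) (mem_set fU).
  by rewrite scaleN1r addrC.
have gg n m i : (i < n)%N -> (n <= m)%N ->
    mean_le (fun t => rho i (g m t - g n t)) (2 * (n.+1%:R^-1 * C)).
  move=> iln nm; have ilm := leq_trans iln nm.
  apply: mean_leW (mean_leD (fg _ _ ilm) (fg _ _ iln)) => [t|].
    rewrite (seminorm_distC (srho i) (f t)).
    exact: (seminorm_triangle (srho i)).
  by rewrite mulr_natl mulr2n lerD2r ler_pM2r// lef_pV2 ?posrE// ler_nat.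
have FF n m i : primitive (rho i) (g m - g n) (F m - F n).
  have := henstock_primitiveD (srho i) (-1) (hF n i) (hF m i).
  by rewrite !scaleN1r ![- _ + _]addrC.
(* The primitives are normalised at [lo], since only their increments are controlled. *)
have /choice[G hG] : forall v, exists l, forall i e, 0 < e ->
    \forall n \near \oo, rho i ((F n v - F n lo) - l) < e.
  move=> v; apply: (seminorm_limit hrho hgen hXc) => i e e0.
  pose N0 := i.+1.
  have e5 : 0 < e / (5 * C) by rewrite divr_gt0// mulr_gt0.
  near \oo => N.
  have iN : (i < N)%N by near: N; exact: nbhs_infty_gt.
  have Ne : N.+1%:R^-1 < e / (5 * C) by near: N; exact: small.
  have close m : (N <= m)%N ->
      rho i ((F m v - F m lo) - (F N v - F N lo)) <= 2 * (N.+1%:R^-1 * C).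
    move=> Nm; have := primitive_increment_le (srho i) v (FF N m i) (gg _ _ _ iN Nm).
    rewrite /= !fctE; congr (rho i _ <= _).
    by rewrite subrACA.
  exists N => m n Nm Nn; apply: le_lt_trans (seminorm_triangle (srho i) (F N v - F N lo) _ _) _.
  rewrite (seminorm_distC (srho i) (F N v - F N lo)).
  apply: le_lt_trans (lerD (close _ Nm) (close _ Nn)) _.
  move: Ne; rewrite ltr_pdivlMr ?mulr_gt0//; set z := N.+1%:R^-1.
  have : 0 < z * C by rewrite mulr_gt0// invr_gt0.
  rewrite mulrCA; lra.
exists G => i e e0.
(* The defect of [f] will be at most [5 * z]: [3 * z] for the variation of [G - F n], [z] for the
   defect of [g n] and [z] for the mean of [rho i (f t - g n t)]. *)
have e5 : 0 < e / (5 * C) by rewrite divr_gt0// mulr_gt0.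
near \oo => n.
have iln : (i < n)%N by near: n; exact: nbhs_infty_gt.
have ne : n.+1%:R^-1 < e / (5 * C) by near: n; exact: small.
pose z := n.+1%:R^-1 * C.
have z0 : 0 < z by rewrite mulr_gt0// invr_gt0.
have near_G s : chain lo hi s -> \sum_(c <- s)
   rho i (G (right_end c) - G (left_end c) - (F n (right_end c) - F n (left_end c)))
     <= 3 * z.
  move=> cs.
  have := @sum_increment_limit (rho i) G (fun m v => F m v - F m lo) s (srho i)
     (fun v e e0 => hG v i e e0) z z0.
  (* Here [m] depends on the chain [s] but [n] does not: the bound [2 * z] on the variation of
     [F m - F n] is uniform in [m >= n]. *)
  move=> hs; near \oo => m.
  have nm : (n <= m)%N by near: m; exact: nbhs_infty_ge.
  have hs' : \sum_(c <- s)
    rho i (G (right_end c) - G (left_end c) - (F m (right_end c) - F m (left_end c))) <= z.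
    apply/ltW; near: m; apply: filterS hs => m; apply: le_lt_trans.
    by apply: ler_sum => c _; rewrite [X in _ <= rho i (_ - X)]subrACA subrr subr0.
  have := primitive_variation_le (srho i) (FF n m i) (gg _ _ _ iln nm) cs.
  move=> /(lerD hs'); rewrite -big_split/= => hsum.
  apply: le_trans (_ : z + 2 * z <= _); last lra.
  apply: le_trans hsum; apply: ler_sum => c _; rewrite !fctE.
  apply: le_trans (seminorm_triangle (srho i) (F m (right_end c) - F m (left_end c)) _ _) _.
  by rewrite lerD2l subrACA lexx.
near=> s.
have cs : chain lo hi s by near: s; exact: near_chain.
have h1 := near_G s cs.
have h2 : \sum_(c <- s) henstock_defect (rho i) (g n) (F n) c < z.
  by near: s; exact: hF.
have h3 : riemann_sum (fun t => rho i (f t - g n t)) s <= z.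
  by near: s; exact: fg.
apply: le_lt_trans (_ : 5 * z < _); last first.
  by move: ne; rewrite ltr_pdivlMr ?mulr_gt0// mulrCA.
have {h3} := lerD (lerD h1 (ltW h2)) h3.
rewrite /riemann_sum -!big_split/= => hs; apply: le_trans (_ : 3 * z + z + z <= _); last lra.
apply: le_trans hs; apply: (ler_sum_all (chain_width_gt0 cs)) => c w0.
rewrite mulrC -{1}(gtr0_norm w0) -(seminormZ (srho i)) /henstock_defect.
apply: le_trans (lerD (seminormD (srho i) _ _) (lexx _)).
apply: le_trans (seminormB (srho i) _ _).
rewrite subrKA scalerBr opprB addrA subrK.
by [].
Unshelve. all: by end_near. Qed.

End L_functions_closed.

(** * Completeness of U^p *)

Lemma divr_exp_small (R : realType) (r C e : R) : 2 <= r -> 0 < e ->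
  exists K, forall k, (K <= k)%N -> C / r ^+ k < e.
Proof.
move=> r2 e0; exists (Num.truncn (C / e)).+1 => k Kk.
have r0 : 0 < r by rewrite (lt_le_trans _ r2).
rewrite ltr_pdivrMr ?exprn_gt0// mulrC -ltr_pdivrMr//.
apply: lt_le_trans (truncnS_gt _) _.
apply: (@le_trans _ _ (2 ^+ k)).
  by rewrite -natrX ler_nat (leq_trans Kk)// ltnW// ltn_expl.
by rewrite lerXn2r// nnegrE// ltW.
Qed.

Section U_functions_complete.
Context {R : realType} {a b : R} (hab : a < b) {X : preTopologicalLmodType R}.
Local Notation I := (interval_type a b).
Local Notation mean_le := (mean_le hab).
Context (rho : nat -> X -> R) (p : R) (hp : 1 <= p).
Hypothesis hrho : forall i, continuous_seminorm (rho i).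
Hypothesis hgen : generates_topology rho.
Hypothesis hXc : sequentially_complete X.

Let srho i : seminorm (rho i). Proof. by case: (hrho i). Qed.
Let p0 : 0 < p. Proof. exact: lt_le_trans hp. Qed.
Let pge0 : 0 <= p. Proof. exact: ltW. Qed.
(** The constant of [(x + y) ^ p <= r * (x ^ p + y ^ p)]. Each step of a telescoping sum costs one
    such factor, which the weights [r ^+ j] in [W] pay for. *)
Let r : R := 2 `^ p.
Let r2 : 2 <= r. Proof. by rewrite /r le1r_powR// ler1n. Qed.
Let r0 : 0 < r. Proof. by rewrite powR_gt0. Qed.

Let powR_lt_root (x e : R) : 0 <= x -> 0 <= e -> x `^ p < e `^ p -> x < e.
Proof.
move=> x0 e0; rewrite !ltNge; apply: contra => ex.
by rewrite ge0_ler_powR ?nnegrE.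
Qed.

Let powRD_r (x y : R) : 0 <= x -> 0 <= y -> (x + y) `^ p <= r * (x `^ p + y `^ p).
Proof. exact: powRD_le. Qed.

Lemma U_functions_dominated (f : I -> X) :
  (forall i, exists M, mean_le (fun t => rho i (f t) `^ p) M) -> U_functions p f.
Proof.
move=> hf q hq; have [n [C [C0 hC]]] := dominated_seminorm srho hgen hq.
apply/(upper_mean_lty hab).
have [M hM] : exists M, mean_le (fun t => (\sum_(i < n) rho i (f t)) `^ p) M.
  elim: n {hC} => [|n [M hM]].
    exists 0; apply: mean_leW (mean_le_cst hab 0) => [t|]; last by rewrite mul0r.
    by rewrite big_ord0 powR0// gt_eqF.
  have [N hN] := hf n; exists (r * (M + N)).
  apply: mean_leW (mean_leZ (ltW r0) (mean_leD hM hN)) => // t.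
  rewrite big_ord_recr/= powRD_r ?(seminorm_ge0 (srho _))//.
  by apply: sumr_ge0 => i _; exact: seminorm_ge0.
exists (C `^ p * M); apply: mean_leW (mean_leZ (powR_ge0 C p) hM) => // t.
have S0 : 0 <= \sum_(i < n) rho i (f t).
  by apply: sumr_ge0 => i _; exact: seminorm_ge0.
by rewrite -powRM// ge0_ler_powR ?nnegrE ?mulr_ge0 ?(seminorm_ge0 hq.1).
Qed.

Section fast_sequence.
Variables (v : nat -> I -> X).

Let d j t := v j.+1 t - v j t.
Let W j t := r ^+ j * \sum_(i < j.+1) rho i (d j t) `^ p.
Let PW n t := \sum_(j < n) W j t.

(** In the mean of [W j], [r ^- j] offsets the weight and [1 / j.+1] the number of semi-norms; what
    is left, [1 / 2 ^+ j], has partial sums at most [2]. *)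
Hypothesis hv : forall j i, (i <= j)%N ->
  mean_le (fun t => rho i (d j t) `^ p) (r ^- j / 2 ^+ j / j.+1%:R).

Let W_ge0 j t : 0 <= W j t.
Proof.
rewrite mulr_ge0 ?exprn_ge0 ?(ltW r0)//.
by apply: sumr_ge0 => i _; exact: powR_ge0.
Qed.

Let W_mean j : mean_le (W j) (2 / 2 ^+ j.+1).
Proof.
have := mean_leZ (exprn_ge0 j (ltW r0)) (mean_le_sum (n := j.+1)
  (g := fun i t => rho i (d j t) `^ p)
  (M := fun=> r ^- j / 2 ^+ j / j.+1%:R) (fun i ij => @hv j i ij)).
apply: mean_leW => //.
rewrite sumr_const card_ord -[_ *+ _]mulr_natr mulfVK// mulrA mulfV ?mul1r.
  by rewrite exprS invfM mulrA mulfV// mul1r.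
by rewrite expf_neq0// gt_eqF.
Qed.

(** Splitting off [d k] multiplies the remaining distance by [r], which turns the weight [r ^+ k]
    into [r ^+ k.+1], the one of the induction hypothesis. *)
Let dist_le i k l t : (i <= k)%N ->
  r ^+ k * rho i (v (k + l)%N t - v k t) `^ p <= r * (PW (k + l) t - PW k t).
Proof.
elim: l k => [|l IH] k ik.
  rewrite addn0 !subrr (seminorm0 (srho i)) powR0 ?mulr0//.
  by rewrite gt_eqF.
have := IH k.+1 (leq_trans ik (leqnSn k)); rewrite addSnnS.
set y := rho i (v (k + l.+1)%N t - v k.+1 t) => hy.
have tri : rho i (v (k + l.+1)%N t - v k t) <= rho i (d k t) + y.
  by rewrite [leRHS]addrC; exact: (seminorm_triangle (srho i)).
have dW : r ^+ k * rho i (d k t) `^ p <= W k t.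
  rewrite ler_wpM2l ?exprn_ge0 ?(ltW r0)//.
  rewrite (bigD1 (Ordinal (ik : (i < k.+1)%N)))//= lerDl.
  by apply: sumr_ge0 => j _; exact: powR_ge0.
have PWS : PW k.+1 t = PW k t + W k t by rewrite /PW big_ord_recr.
apply: le_trans (_ : r ^+ k * (r * (rho i (d k t) `^ p + y `^ p)) <= _).
  rewrite ler_wpM2l ?exprn_ge0 ?(ltW r0)//.
  apply: le_trans (powRD_r (seminorm_ge0 (srho i) _) (seminorm_ge0 (srho i) _)).
  by rewrite ge0_ler_powR ?nnegrE ?addr_ge0 ?(seminorm_ge0 (srho i)).
have := ler_wpM2l (ltW r0) dW.
rewrite PWS exprS in hy.
have -> : r ^+ k * (r * (rho i (d k t) `^ p + y `^ p)) =
  r * (r ^+ k * rho i (d k t) `^ p) + r * r ^+ k * y `^ p by ring.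
move: hy; rewrite !mulrBr mulrDr; lra.
Qed.

Let PW_ge0 n t : 0 <= PW n t.
Proof. by apply: sumr_ge0 => j _; exact: W_ge0. Qed.

(* Where [PW] is bounded the sequence converges; where it is not, any value
   is dominated by a multiple of a partial sum of [W]. *)
Lemma fast_sequence_limit : exists f : I -> X, forall i k eta, (i <= k)%N ->
  0 < eta -> mean_le (fun t => rho i (f t - v k t) `^ p)
    (r * r / r ^+ k * 2 + r * eta * (b - a)).
Proof.
have /choice[f hf] : forall t, exists l, (exists B, forall n, PW n t <= B) ->
    forall i e, 0 < e -> \forall n \near \oo, rho i (v n t - l) < e.
  move=> t; have [[B hB]|nB] := pselect (exists B, forall n, PW n t <= B); last first.
    by exists 0 => /nB.
  have [i e e0|l hl] := seminorm_limit hrho hgen hXc (u := v^~ t); last by exists l.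
  have e20 : 0 < e / 2 by rewrite divr_gt0.
  have [K hK] := divr_exp_small (r * B) r2 (powR_gt0 p e20).
  pose N := maxn i K.
  have close m : (N <= m)%N -> rho i (v m t - v N t) < e / 2.
    move=> Nm; apply: powR_lt_root; rewrite ?(seminorm_ge0 (srho i)) ?(ltW e20)//.
    apply: le_lt_trans (hK N (leq_maxr _ _)).
    rewrite ler_pdivlMr ?exprn_gt0// mulrC.
    have := @dist_le i N (m - N) t (leq_maxl _ _); rewrite subnKC//.
    move=> /le_trans; apply; rewrite ler_wpM2l ?(ltW r0)//.
    by rewrite lerBlDr (le_trans (hB m))// lerDl PW_ge0.
  exists N => m n Nm Nn; rewrite (splitr e).
  apply: le_lt_trans (seminorm_triangle (srho i) (v N t) _ _) _.
  by apply: ltrD; rewrite ?close// (seminorm_distC (srho i)) close.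
exists f => i k eta ik eta0.
have rk0 : 0 < r ^+ k by rewrite exprn_gt0.
pose x t := rho i (f t - v k t) `^ p.
(* One factor [r] comes from inserting [v m t] between [f t] and [v k t], the other from [dist_le];
   [r * eta] accounts for the distance from [v m t] to [f t]. *)
pose c := r ^+ k / (r * r).
have c0 : 0 < c by rewrite divr_gt0// mulr_gt0.
have : mean_le (fun t => (x t - r * eta) * c) 2.
  apply: (mean_le_countable W_ge0 W_mean) => [n|t]; first exact: sum_half_exp.
  have [B|nB] := pselect (exists B, forall n, PW n t <= B); last first.
    apply: contrapT => nJ; apply: nB; exists ((x t - r * eta) * c) => n.
    by rewrite leNgt; apply/negP => h; apply: nJ; exists n; exact: ltW.
  have eta1 : 0 < eta `^ p^-1 by rewrite powR_gt0.
  near \oo => m.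
  have km : (k <= m)%N by near: m; exact: nbhs_infty_ge.
  have hm : rho i (v m t - f t) < eta `^ p^-1 by near: m; exact: hf.
  have {}hm : rho i (f t - v m t) `^ p <= eta.
    rewrite (seminorm_distC (srho i)).
    apply: (@le_trans _ _ ((eta `^ p^-1) `^ p)).
      by rewrite ge0_ler_powR ?nnegrE ?(seminorm_ge0 (srho i)) ?(ltW eta1)// ltW.
    by rewrite -powRrM mulVf ?gt_eqF// powRr1// ltW.
  exists m; rewrite -/(PW m t) /c mulrA ler_pdivrMr ?mulr_gt0//.
  have hx : x t <= r * (rho i (f t - v m t) `^ p + rho i (v m t - v k t) `^ p).
    apply: le_trans (powRD_r (seminorm_ge0 (srho i) _) (seminorm_ge0 (srho i) _)).
    rewrite ge0_ler_powR ?nnegrE ?addr_ge0 ?(seminorm_ge0 (srho i))//.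
    exact: (seminorm_triangle (srho i)).
  have := @dist_le i k (m - k) t ik; rewrite subnKC// => hd.
  have {}hd : r ^+ k * rho i (v m t - v k t) `^ p <= r * PW m t.
    by apply: le_trans hd _; rewrite ler_wpM2l ?(ltW r0)// gerBl PW_ge0.
  apply: (@le_trans _ _ (r * rho i (v m t - v k t) `^ p * r ^+ k)).
    rewrite ler_wpM2r ?(ltW rk0)// lerBlDr.
    apply: le_trans hx _; rewrite mulrDr addrC lerD2l.
    by rewrite ler_wpM2l ?(ltW r0).
  rewrite -mulrA [_ * r ^+ k]mulrC.
  apply: le_trans (ler_wpM2l (ltW r0) hd) _.
  by rewrite le_eqVlt; apply/orP; left; apply/eqP; ring.
have ci : 0 <= c^-1 by rewrite invr_ge0 ltW.
move=> /(mean_leZ ci)/mean_leD/(_ (mean_le_cst hab (r * eta))).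
apply: mean_leW => [t|].
  by rewrite [c^-1 * _]mulrC mulfK ?gt_eqF// subrK.
by rewrite /c invf_div lexx.
Unshelve. all: by end_near.
Qed.

End fast_sequence.

Lemma U_functions_complete (u : nat -> I -> X) :
  (forall n, U_functions p (u n)) ->
  (forall i e, 0 < e -> exists N, forall m n, (N <= m)%N -> (N <= n)%N ->
     U_seminorm p (rho i) (u m - u n) < e) ->
  exists2 f, U_functions p f & forall i e, 0 < e ->
    exists N, forall n, (N <= n)%N -> U_seminorm p (rho i) (f - u n) < e.
Proof.
move=> uU uC.
have Usub (f g : I -> X) : U_functions p f -> U_functions p g -> U_functions p (f - g).
  move=> fU gU; have [_ Ulin] := @U_functions_submod_closed R a b X p hp.
  have /set_mem := Ulin (-1) g f (mem_set gU) (mem_set fU).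
  by rewrite scaleN1r addrC.
pose E j := r ^- j / 2 ^+ j / j.+1%:R.
have E0 j : 0 < E j.
  by rewrite /E !divr_gt0// ?invr_gt0 ?exprn_gt0.
have /choice[N hN] : forall j, exists N : nat, forall i, (i <= j)%N ->
    forall m n, (N <= m)%N -> (N <= n)%N ->
    U_seminorm p (rho i) (u m - u n) < E j `^ p^-1.
  move=> j; have /choice[N hN] := fun i => uC i _ (powR_gt0 p^-1 (E0 j)).
  exists (\max_(i < j.+1) N i)%N => i ij m n Nm Nn.
  have iN : (N i <= \max_(i < j.+1) N i)%N.
    exact: (@leq_bigmax _ (fun i : 'I_j.+1 => N i) (Ordinal (ij : (i < j.+1)%N))).
  by apply: hN; apply: leq_trans iN _.
(* The maximum puts [phi j] past every [N k] with [k <= j], so that [phi j] and [phi j.+1] are both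
   past [N j]. *)
pose phi j := (\max_(k < j.+1) N k)%N.
have phiN k j : (k <= j)%N -> (N k <= phi j)%N.
  by move=> kj; exact: (@leq_bigmax _ (fun i : 'I_j.+1 => N i) (Ordinal (kj : (k < j.+1)%N))).
have hv j i : (i <= j)%N ->
    mean_le (fun t => rho i (u (phi j.+1) t - u (phi j) t) `^ p) (E j).
  move=> ij; have := hN j i ij (phi j.+1) (phi j) (phiN _ _ (leqnSn j)) (phiN _ _ (leqnn j)).
  move=> /(U_seminorm_lt hab hp (Usub _ _ (uU _) (uU _) _ (hrho i))).
  by rewrite -powRrM mulVf ?gt_eqF// powRr1// ltW.
have [f hf] := fast_sequence_limit (v := u \o phi) hv.
have fmean i k : (i <= k)%N -> exists M,
    mean_le (fun t => rho i (f t - u (phi k) t) `^ p) M.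
  by move=> ik; eexists; exact: hf ik ltr01.
have fU : U_functions p f.
  apply: U_functions_dominated => i; have [M hM] := fmean i i (leqnn i).
  have [M' hM'] := (upper_mean_lty hab _ _ _).1 (uU (phi i) _ (hrho i)).
  exists (r * (M + M')).
  apply: mean_leW (mean_leZ (ltW r0) (mean_leD hM hM')) => // t.
  apply: le_trans (powRD_r (seminorm_ge0 (srho i) _) (seminorm_ge0 (srho i) _)).
  rewrite ge0_ler_powR ?nnegrE ?addr_ge0 ?(seminorm_ge0 (srho i))//.
  by rewrite -{1}(subrK (u (phi i) t) (f t)) (seminormD (srho i)).
exists f => // i e e0.
have e20 : 0 < e / 2 by rewrite divr_gt0.
have e40 : 0 < e / 4 by rewrite divr_gt0.
have ep : 0 < (e / 4) `^ p / 2 by rewrite divr_gt0// powR_gt0.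
have [K hK] := divr_exp_small (r * r * 2) r2 ep.
have [J hJ] : exists J, forall j, (J <= j)%N -> E j `^ p^-1 <= e / 2.
  have [J hJ] := divr_exp_small 1 r2 (powR_gt0 p e20).
  exists J => j Jj; rewrite -[leRHS](powRVK hp (ltW e20)).
  rewrite ge0_ler_powR ?nnegrE ?invr_ge0 ?powR_ge0 ?(ltW (E0 _))//.
  apply: le_trans (ltW (hJ j Jj)); rewrite div1r /E -mulrA.
  by rewrite ger_pMr ?invr_gt0 ?exprn_gt0// -invfM invf_le1 ?mulr_gt0 ?exprn_gt0// mulr_ege1 ?exprn_ege1 ?ler1n.
pose J' := maxn i J; pose k := maxn J' K.
have ik : (i <= k)%N by rewrite (leq_trans (leq_maxl i J))// leq_maxl.
have Kk : (K <= k)%N by exact: leq_maxr.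
have c0 : 0 < r * (b - a) by rewrite mulr_gt0// subr_gt0.
have close : U_seminorm p (rho i) (f - u (phi k)) <= e / 4.
  apply: (U_seminorm_le (hab := hab)) => //; first exact: ltW.
  (* The choice of [eta] gives [r * eta * (b - a)] the value [(e / 4) ^ p / 2], and [K] makes the
     other term no larger. *)
  apply: mean_leW (hf i k ((e / 4) `^ p / 2 / (r * (b - a))) ik (divr_gt0 ep c0)) => //.
  rewrite [r * _ * (b - a)]mulrAC [r * (b - a) * _]mulrC mulfVK ?gt_eqF//.
  by rewrite [leRHS]splitr lerD2r mulrAC ltW// hK.
exists (N J') => n Nn.
have -> : f - u n = (f - u (phi k)) + (u (phi k) - u n) by rewrite subrKA.
apply: le_lt_trans (U_seminormD hab hp (srho i) _ _) _.
- exact: (Usub _ _ fU (uU _) _ (hrho i)).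
- exact: (Usub _ _ (uU _) (uU _) _ (hrho i)).
have e4 : e / 4 < e / 2 by lra.
rewrite (splitr e); apply: ltr_leD; first exact: le_lt_trans e4.
apply: le_trans (hJ J' (leq_maxr _ _)); apply/ltW/hN => //; first exact: leq_maxl.
exact/phiN/leq_maxl.
Qed.

End U_functions_complete.

(** * The topology of a subspace *)

Section subspace_topology.
Context {R : realType} {V : preTopologicalLmodType R} (Q : nat -> V -> R).
Hypothesis hQ : forall i, seminorm (Q i).
Hypothesis hgen : generates_topology Q.
Context {S : set V} (hS : submod_closed [in S]).
Local Notation W := (topological_subspace hS).

Definition subspace_val (x : W) : V := \val (x : linear_subspace hS).
Definition subspace_seminorm (i : nat) (x : W) : R := Q i (subspace_val x).

Lemma subspace_valP (x : W) : S (subspace_val x).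
Proof. exact: (set_mem (valP (x : linear_subspace hS))). Qed.

Lemma subspace_valB (x y : W) : subspace_val (x - y) = subspace_val x - subspace_val y.
Proof. exact: (GRing.valB (x : linear_subspace hS) y). Qed.

Lemma subspace_seminormP i : seminorm (subspace_seminorm i).
Proof.
split=> [x|x y|c x]; first exact: (seminorm_ge0 (hQ i)).
  exact: (seminormD (hQ i) (subspace_val x) (subspace_val y)).
exact: (seminormZ (hQ i) c (subspace_val x)).
Qed.

Lemma subspace_generated : generates_topology subspace_seminorm.
Proof.
move=> A; split=> [[B /hgen oB <-] x /= Bx|oA].
  have [F [e [finF e0 FB]]] := oB _ Bx.
  exists F, e; split => // y yF; apply: FB => i Fi.
  by rewrite -[\val y - _]subspace_valB; exact: yF.
(* The largest ambient open set whose trace lies in [A]. *)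
exists (\bigcup_(U in [set U | open U /\ subspace_val @^-1` U `<=` A]) U).
  by apply: bigcup_open => U [].
apply/seteqP; split => [y [U [_ UA] /UA//]|x /= Ax].
have [F [e [/finite_set_nat_bounded[n Fn] e0 FA]]] := oA x Ax.
have := near_seminorms_lt hQ hgen n (subspace_val x) e0.
rewrite nbhsE => -[U [oU Ux] hU]; exists U => //; split => // y Uy.
apply: FA => i /Fn ilt; rewrite /subspace_seminorm subspace_valB.
exact: (hU _ Uy (Ordinal ilt)).
Qed.

End subspace_topology.

(** * The quotient by the null space *)

Section separated_topology.
Local Open Scope quotient_scope.
Context {R : realType} {V : preTopologicalLmodType R} (Q : nat -> V -> R).
Hypothesis hQ : forall i, seminorm (Q i).
Hypothesis hgen : generates_topology Q.
Local Notation W := (separated_space V).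
Local Notation quot := (ring_quotient.Quotient.quot (@null_pred R V)).

Definition to_separated (x : V) : W := \pi_quot x.
Definition separated_seminorm (i : nat) (x : W) : R := Q i (repr (x : quot)).

Lemma to_separatedD : {morph to_separated : x y / x + y}.
Proof. exact: (raddfD (\pi_quot)). Qed.

Lemma to_separatedB : {morph to_separated : x y / x - y}.
Proof. exact: (raddfB (\pi_quot)). Qed.

Lemma to_separatedZ c : {morph to_separated : x / c *: x}.
Proof. by move=> x; rewrite -[RHS]/(separated_scale c (\pi_quot x)) pi_separated_scale. Qed.

Lemma to_separatedK (x : W) : to_separated (repr (x : quot)) = x.
Proof. exact: reprK. Qed.

(** [x] and the chosen representative of its class differ by a vector that every continuous
    semi-norm annihilates, so the choice made by [repr] does not matter. *)
Lemma separated_seminormE i x : separated_seminorm i (to_separated x) = Q i x.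
Proof.
have /asboolP/(_ (Q i) (generated_continuous_seminorm hQ hgen i)) :
    null_pred (repr (\pi_quot x) - x).
  rewrite -[null_pred _]/(_ \in @null_pred R V).
  by rewrite ring_quotient.Quotient.idealrBE reprK.
rewrite /separated_seminorm /to_separated => h; apply/eqP; rewrite eq_le.
rewrite -{1}(subrK x (repr _)) (le_trans (seminormD (hQ i) _ _)) ?h ?add0r//=.
rewrite -{1}(subKr (repr (\pi_quot x)) x).
by rewrite (le_trans (seminormB (hQ i) _ _))// h addr0.
Qed.

Lemma separated_seminormP i : seminorm (separated_seminorm i).
Proof.
split=> [x|x y|c x]; first exact: (seminorm_ge0 (hQ i)).
  rewrite -(to_separatedK x) -(to_separatedK y) -to_separatedD !separated_seminormE.
  exact: (seminormD (hQ i)).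
rewrite -(to_separatedK x) -to_separatedZ !separated_seminormE.
exact: (seminormZ (hQ i)).
Qed.

Lemma separated_generated : generates_topology separated_seminorm.
Proof.
move=> A; rewrite -[open A]/(open (to_separated @^-1` A)) hgen; split=> oA x Ax.
  have [|F [e [finF e0 FA]]] := oA (repr (x : quot)).
    by rewrite /preimage/= to_separatedK.
  exists F, e; split => // y yF; rewrite -(to_separatedK y).
  apply: FA => i Fi; have := yF i Fi.
  by rewrite -{1}(to_separatedK x) -{1}(to_separatedK y) -to_separatedB separated_seminormE.
have [F [e [finF e0 FA]]] := oA (to_separated x) Ax.
exists F, e; split => // y yF; apply: FA => i Fi.
by rewrite -to_separatedB separated_seminormE; exact: yF.
Qed.

(** [null_pred] refers to all continuous semi-norms while only the [Q i] are known to vanish;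
    domination by finitely many of them closes the gap. *)
Lemma separated_separating : separating separated_seminorm.
Proof.
move=> x x0; apply: contrapT => nx; move: x0; apply/negP; rewrite negbK.
have Q0 i : Q i (repr (x : quot)) = 0.
  by apply: contrapT => h; apply: nx; exists i; exact/eqP.
rewrite -(to_separatedK x) -[0 : W](_ : to_separated 0 = _); last first.
  by rewrite -(subrr 0) to_separatedB subrr.
apply/eqP; suff /eqP : repr (x : quot) == 0 %[mod quot] by [].
rewrite -ring_quotient.Quotient.idealrBE subr0.
apply/asboolP => q qc; have [n [C [_ hC]]] := dominated_seminorm hQ hgen qc.
apply/eqP; rewrite eq_le (seminorm_ge0 qc.1) andbT (le_trans (hC _))//.
by rewrite big1 ?mulr0.
Qed.

Lemma separated_frechet : frechet W.
Proof.
have cont := generated_continuous_seminorm separated_seminormP separated_generated.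
split; last by exists separated_seminorm; split => //; exact: separated_generated.
split; exists nat, separated_seminorm; split => //.
- exact: separated_seminormP.
- exact: separated_generated.
- exact: separated_separating.
Qed.

(** Passing to representatives changes no semi-norm, so Cauchy sequences lift and limits descend. *)
Lemma separated_sequentially_complete :
  sequentially_complete V -> sequentially_complete W.
Proof.
move=> hV u uC; have cont := generated_continuous_seminorm separated_seminormP separated_generated.
have [|l ul] := hV (fun n => repr (u n : quot)).
  apply: (seminorm_cauchy_dominated hQ hgen) => i e e0.
  have [N hN] := uC _ (cont i) e e0; exists N => m n Nm Nn.
  by rewrite -separated_seminormE to_separatedB !to_separatedK; exact: hN.
exists (to_separated l).
apply/(cvg_seminormP separated_seminormP separated_generated) => i e e0.
have := (cvg_seminormP hQ hgen _ _).1 ul i e e0; apply: filterS => n.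
by rewrite -separated_seminormE to_separatedB to_separatedK.
Qed.

End separated_topology.

(** * The spaces U^p and L^p *)

Section L_space.
Context {R : realType} {a b : R} (hab : a < b) {X : preTopologicalLmodType R}.
Context (rho : nat -> X -> R) (p : R) (hp : 1 <= p).
Hypothesis hrho : forall i, continuous_seminorm (rho i).
Hypothesis hgen : generates_topology rho.
Hypothesis hXc : sequentially_complete X.
Local Notation U := (U_space a b rho hp).

Definition U_space_seminorm (i : nat) (f : U) : R := U_seminorm p (rho i) (U_fun f).

Lemma U_funP (f : U) : U_functions p (U_fun f).
Proof.
exact: (set_mem (valP (f : linear_subspace (@U_functions_submod_closed R a b X p hp)))).
Qed.

Lemma U_funB (f g : U) : U_fun (f - g) = U_fun f - U_fun g.
Proof.
exact: (GRing.valB (f : linear_subspace (@U_functions_submod_closed R a b X p hp)) g).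
Qed.

Lemma U_fun_upper_mean i (f : U) : (upper_mean p (rho i) (U_fun f) < +oo)%E.
Proof. exact: U_funP. Qed.

(** Homogeneity follows from its inequality alone, applied to [k] and to the inverse of [k]. *)
Lemma U_space_seminormP i : seminorm (U_space_seminorm i).
Proof.
have s := (hrho i).1.
have Zle k (f : U) : U_space_seminorm i (k *: f) <= `|k| * U_space_seminorm i f.
  exact: (U_seminormZ_le hab hp s k (U_fun_upper_mean i f)).
split=> [f|f g|k f]; first exact: U_seminorm_ge0.
  exact: (U_seminormD hab hp s (U_fun_upper_mean i f) (U_fun_upper_mean i g)).
apply/le_anti/andP; split; first exact: Zle.
have [->|k0] := eqVneq k 0; first by rewrite normr0 mul0r; exact: U_seminorm_ge0.
rewrite -{1}(scalerK k0 f) -ler_pdivlMl ?normr_gt0// -normfV.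
exact: Zle.
Qed.

(** The open sets of [seminormed] are the [seminorm_open] sets by construction, so both sides are
    convertible. *)
Lemma U_space_generated : generates_topology U_space_seminorm.
Proof. by []. Qed.

Lemma L_space_submod_closed : submod_closed [in L_space a b rho hp].
Proof.
have [U0 Ulin] := @U_functions_submod_closed R a b X p hp.
split; [apply: mem_set|move=> k f g /set_mem fL /set_mem gL; apply: mem_set].
  apply/(L_functionsP hab hp); split; first exact: U_funP.
  move=> q [sq _]; exists (fun=> 0) => e e0; apply: filterE => s.
  rewrite /= big1// => c _.
  have -> : henstock_defect q (U_fun (0 : U)) (fun=> 0) c = q (0 - 0 - tagged_width c *: 0) by [].
  by rewrite scaler0 !subr0 seminorm0.
have [_ fP] := (L_functionsP hab hp _).1 fL.
have [_ gP] := (L_functionsP hab hp _).1 gL.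
apply/(L_functionsP hab hp); split; first exact: U_funP.
move=> q qc; have [F FP] := fP q qc; have [G GP] := gP q qc.
by exists (k *: F + G); exact: (henstock_primitiveD qc.1 k FP GP).
Qed.

Lemma L_space_closed : closed (L_space a b rho hp).
Proof.
move=> f fcl; apply: (L_functions_closed hab hp hrho hgen hXc (U_funP f)) => n e e0.
have := near_seminorms_lt U_space_seminormP U_space_generated n f e0.
move=> /fcl[g [gL hg]]; exists (U_fun g) => // i ilt.
rewrite -U_funB -/(U_space_seminorm i (f - g)).
by rewrite (seminorm_distC (U_space_seminormP i)); exact: (hg (Ordinal ilt)).
Qed.

(** The limit is found among the elements of [U_functions]; the terms of the sequence themselves
    approximate it, so [L_functions_closed] puts it in [L_functions]. *)
Lemma L_space_sequentially_complete (hL : submod_closed [in L_space a b rho hp]) :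
  sequentially_complete (topological_subspace hL).
Proof.
move=> u uC.
pose Q := subspace_seminorm U_space_seminorm (hS := hL).
have sQ i : seminorm (Q i) by exact: (subspace_seminormP U_space_seminormP).
have gQ : generates_topology Q by exact: (subspace_generated U_space_seminormP U_space_generated).
have cQ := generated_continuous_seminorm sQ gQ.
pose v n := U_fun (subspace_val (u n)).
have vL n : L_functions p (v n) by exact: (subspace_valP (u n)).
have QE i (x y : topological_subspace hL) : Q i (x - y) =
    U_seminorm p (rho i) (U_fun (subspace_val x) - U_fun (subspace_val y)).
  by rewrite /Q /subspace_seminorm subspace_valB /U_space_seminorm U_funB.
have vU n : U_functions p (v n) := L_functions_sub hab (vL n).
have vC i e : 0 < e -> exists N, forall m n, (N <= m)%N -> (N <= n)%N ->
    U_seminorm p (rho i) (v m - v n) < e.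
  move=> e0; have [N hN] := uC _ (cQ i) e e0.
  by exists N => m n Nm Nn; rewrite -QE; exact: hN.
have [f fU hf] := U_functions_complete hab hp hrho hgen hXc vU vC.
have fL : L_functions p f.
  apply: (L_functions_closed hab hp hrho hgen hXc fU) => n e e0.
  have /choice[N hN] := fun i => hf i e e0.
  exists (v (\max_(i < n) N i)%N) => // i ilt; apply: hN.
  exact: (@leq_bigmax _ (fun i : 'I_n => N i) (Ordinal ilt)).
have [l lE] : exists l : topological_subspace hL, U_fun (subspace_val l) = f.
  pose f1 : linear_subspace (@U_functions_submod_closed R a b X p hp) :=
    exist _ f (mem_set fU).
  by exists (exist _ (f1 : U) (mem_set (fL : L_space a b rho hp f1))).
exists l; apply/(cvg_seminormP sQ gQ) => i e e0; have [N hN] := hf i e e0.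
suff h n : (N <= n)%N -> Q i (u n - l) < e by exists N.
move=> Nn; have := hN n Nn; rewrite -lE -(QE i l (u n)).
by rewrite (seminorm_distC (sQ i) l (u n)).
Qed.

End L_space.

Theorem corollary13 (R : realType) (a b : R) (hab : a < b)
  (X : preTopologicalLmodType R)
  (hX : frechet X) (hXc : sequentially_complete X)
  (rho : nat -> X -> R)
  (hrho : forall i, continuous_seminorm (rho i))
  (hsep : separating rho) (hgen : generates_topology rho)
  (p : R) (hp : 1 <= p) :
  (L_functions p : set (interval_type a b -> X)) `<=` U_functions p /\
  exists hL : submod_closed [in L_space a b rho hp],
    [/\ closed (L_space a b rho hp),
        countably_generated (topological_subspace hL),
        sequentially_complete (topological_subspace hL),
        frechet (separated_space (topological_subspace hL))
      & sequentially_complete (separated_space (topological_subspace hL))].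
Proof.
split; first exact: L_functions_sub.
have sU := U_space_seminormP hab hp hrho.
have gU := @U_space_generated R a b X rho p hp.
have hL := L_space_submod_closed hab rho hp.
have sL := subspace_seminormP sU hL.
have gL := subspace_generated sU gU (hS := hL).
have cL := L_space_sequentially_complete hab hrho hgen hXc (hL := hL).
exists hL; split.
- exact: L_space_closed.
- by exists (subspace_seminorm (@U_space_seminorm R a b X rho p hp) (hS := hL));
    split => //; exact: generated_continuous_seminorm.
- exact: cL.
- exact: separated_frechet sL gL.
- exact: separated_sequentially_complete sL gL cL.
Qed.
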